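(* Let $(G,\mathbb{P})$ be relatively hyperbolic with a finite generating set $\mathcal{S}$ for $G$. Let $H\le G$ be a relatively quasiconvex subgroup with a finite generating set $\mathcal{T}$, and let $\mathbb{O}$ be the induced peripheral structure on $H$. For each $O=H\cap gPg^{-1}\in\mathbb{O}$ (with $g\in G$, $P\in\mathbb{P}$) let $\delta_O$ denote the distortion of the finitely generated group $O$ in the finitely generated group $gPg^{-1}$. Then the distortion $\Delta_H^G$ of $H$ in $G$ satisfies \[ f\preceq \Delta_H^G\preceq \bar f, \] where $f(n):=\max_{O\in\mathbb{O}}\delta_O(n)$ and $\bar f$ is the superadditive closure of $f$. (If $\mathbb{O}$ is empty, $f$ is taken to be identically zero.)
   Context: **Relative hyperbolicity.** Let $G$ be a countable group and $\mathbb{P}=\{P_1,\dots,P_n\}$ a finite collection of subgroups. $(G,\mathbb{P})$ is relatively hyperbolic if $G$ acts on a connected graph $K$ (edges of length one) such that: $K$ is $\delta$-hyperbolic for some $\delta$; $K$ is fine, i.e. for each $n$ each edge lies in only finitely many circuits (simple closed edge paths) of length $n$; edge stabilizers are finite; there are finitely many orbits of edges; and $\mathbb{P}$ is a set of representatives of the conjugacy classes of infinite vertex stabilizers. (The paper uses several equivalent definitions; this is one of them.) **Relative quasiconvexity.** A symmetric set $\mathcal{S}\subseteq G$ is a relative generating set for $(G,\mathbb{P})$ if $\mathcal{S}\cup P_1\cup\dots\cup P_n$ generates $G$. Let $\mathcal{P}$ be the union of the $P_i$ (nontrivial elements). A metric on $G$ is proper if all its balls are finite. A subgroup $H\le G$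 is relatively quasiconvex in $(G,\mathbb{P})$ if for some (equivalently, any) finite relative generating set $\mathcal{S}$ and some (equivalently, any) proper left invariant metric $d$ on $G$ there is $\kappa$ such that for each geodesic $\bar c$ in $\mathrm{Cayley}(G,\mathcal{S}\cup\mathcal{P})$ connecting two points of $H$, every vertex of $\bar c$ lies within $d$-distance $\kappa$ of $H$. **Induced peripheral structure.** $\mathbb{O}$ is a set of representatives of the $H$-conjugacy classes of elements of $\{H\cap gPg^{-1}: g\in G,\ P\in\mathbb{P},\ H\cap gPg^{-1}\text{ infinite}\}$; it is finite and $(H,\mathbb{O})$ is relatively hyperbolic. It is known that the peripheral subgroups of a finitely generated relatively hyperbolic group are finitely generated, so under the hypotheses the groups $O\in\mathbb{O}$ and $gPg^{-1}$ are finitely generated. **Distortion.** If $G$ has finite generating set $\mathcal{S}$ and a subgroup $H$ has finite generating set $\mathcal{T}$, the distortion is $\Delta_H^G(n)=\max\{|h|_{\mathcal{T}} : h\in H,\ |h|_{\mathcal{S}}\le n\}$, where $|\cdot|$ denotes word length. For monotone functions $f,g\colon[0,\infty)\to[0,\infty)$, $f\preceq g$ means there is $C>0$ with $f(r)\le C\,g(Cr+C)+Cr+C$ for all $r\ge0$; a function on $\mathbb{N}$ is extended to be constant on each $[n,n+1)$. The functions $f\simeq g$ are equivalent if $f\preceq g$ and $g\preceq f$. Up to $\simeq$, distortion does not depend on the finite generating sets. **Superadditive closure.** $f\colon\mathbb{N}\to\mathbb{N}$ is superadditive if $f(a+b)\ge f(a)+f(b)$ for all $a,b$. The superadditive closure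 of $f$ is the smallest superadditive $\bar f\ge f$, given by $\bar f(n)=\max\{f(n_1)+\dots+f(n_r): r\ge1,\ n_1+\dots+n_r=n\}$. *)

(* Defs.v *)
From mathcomp Require Export all_boot all_order all_algebra.
From mathcomp Require Export all_classical all_reals.

Set Implicit Arguments.
Unset Strict Implicit.
Unset Printing Implicit Defensive.

Import Order.TTheory GRing.Theory Num.Theory.

Local Open Scope classical_set_scope.
Local Open Scope group_scope.

(** * Graphs

    A graph is a simple graph given by its adjacency relation [e : rel V].
    Edges have length one, and [x :: p] with [path e x p] is an edge path of
    length [size p] from [x] to [last x p]. *)

Section Graphs.
Variables (V : eqType) (e : rel V).

Definition edge_path (x y : V) (p : seq V) : Prop := path e x p /\ last x p = y.

Definition connected_graph : Prop :=
  inhabited V /\ forall x y, exists p, edge_path x y p.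

Definition geodesic (x y : V) (p : seq V) : Prop :=
  edge_path x y p /\ forall q, edge_path x y q -> (size p <= size q)%N.

(* [v] is at graph distance at most [n] from some vertex of [s]. *)
Definition near_path (n : nat) (s : seq V) (v : V) : Prop :=
  exists w p, [/\ w \in s, edge_path v w p & (size p <= n)%N].

(* Geodesic triangles are [delta]-slim; the other two sides of the triangle are
   covered by permuting x, y, z cyclically. *)
Definition slim_triangles (delta : nat) : Prop :=
  forall x y z p q r, geodesic x y p -> geodesic y z q -> geodesic z x r ->
  forall v, v \in x :: p -> near_path delta ((y :: q) ++ (z :: r)) v.

Definition hyperbolic_graph : Prop := exists delta, slim_triangles delta.

End Graphs.

(* A circuit of length [n] is represented by the cyclic sequence [c] of its
   distinct vertices; rooted and oriented representatives are counted
   separately, which does not affect finiteness (and neither do the degenerate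
   sequences [x; y], the only ones with n < 3). *)
Definition fine_graph (V : eqType) (e : rel V) : Prop :=
  forall (n : nat) (x y : V), e x y ->
    finite_set [set c : seq V | [/\ ucycle e c, size c = n
                                  & next c x = y \/ next c y = x]].

(** * Groups *)

Section Groups.
Variable G : groupType.
Implicit Types (S T H X : set G) (PP OO : set (set G)).

Definition is_subgroup H : Prop := group_closed [in H].

Definition gen S : set G := smallest [set H | is_subgroup H] S.

Definition finite_generating_set S H : Prop := finite_set S /\ gen S = H.

(* g H g^-1; note that the library's [x ^ g] is g^-1 x g. *)
Definition conj_set (g : G) H : set G := [set g * x * g^-1 | x in H].

(** ** Relative hyperbolicity *)

Definition vertex_stabilizer (V : Type) (act : G -> V -> V) (v : V) : set G :=
  [set g | act g v = v].

(* Setwise: inversions of the edge are allowed. *)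
Definition edge_stabilizer (V : Type) (act : G -> V -> V) (x y : V) : set G :=
  [set g | (act g x = x /\ act g y = y) \/ (act g x = y /\ act g y = x)].

Definition graph_action (V : Type) (e : rel V) (act : G -> V -> V) : Prop :=
  [/\ forall v, act 1 v = v,
      forall g h v, act (g * h) v = act g (act h v)
    & forall g x y, e (act g x) (act g y) = e x y].

Definition finitely_many_edge_orbits (V : eqType) (e : rel V)
    (act : G -> V -> V) : Prop :=
  exists E : seq (V * V), forall x y, e x y ->
    exists g a b, (a, b) \in E /\ (act g a = x /\ act g b = y).

(* [PP] is a set of representatives of the classes of the elements of [FF] under
   conjugation by elements of [H]. *)
Definition conj_representatives H (FF PP : set (set G)) : Prop :=
  PP `<=` FF /\
  forall F, FF F -> exists! P, PP P /\ exists2 h, H h & F = conj_set h P.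

(* [V : eqType] is no restriction: classically, every type is an eqType. *)
Definition relatively_hyperbolic PP : Prop :=
  [/\ countable [set: G], finite_set PP &
  exists (V : eqType) (e : rel V) (act : G -> V -> V),
    [/\ symmetric e, irreflexive e & graph_action e act] /\
    [/\ connected_graph e, hyperbolic_graph e & fine_graph e] /\
    [/\ forall x y, e x y -> finite_set (edge_stabilizer act x y),
        finitely_many_edge_orbits e act
      & conj_representatives [set: G]
          [set Q | infinite_set Q /\ exists v, Q = vertex_stabilizer act v] PP]].

(** ** Relative quasiconvexity *)

Definition relative_generating_set PP S : Prop :=
  (forall s, S s -> S s^-1) /\ gen (S `|` \bigcup_(P in PP) P) = [set: G].

Definition peripheral_elements PP : set G :=
  (\bigcup_(P in PP) P) `\` [set 1].

Definition cayley X : rel G := fun x y => x^-1 * y \in X.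

Definition is_metric (R : realType) (d : G -> G -> R) : Prop :=
  [/\ forall x y, d x y = 0%R <-> x = y,
      forall x y, d x y = d y x
    & forall x y z, (d x z <= d x y + d y z)%R].

Definition proper_metric (R : realType) (d : G -> G -> R) : Prop :=
  forall x (r : R), finite_set [set y | (d x y <= r)%R].

Definition left_invariant (R : realType) (d : G -> G -> R) : Prop :=
  forall g x y, d (g * x) (g * y) = d x y.

Definition relatively_quasiconvex (R : realType) PP H : Prop :=
  is_subgroup H /\
  exists S (d : G -> G -> R) (kappa : R),
    [/\ finite_set S, relative_generating_set PP S,
        [/\ is_metric d, proper_metric d & left_invariant d] &
        forall x y p, H x -> H y ->
          geodesic (cayley (S `|` peripheral_elements PP)) x y p ->
        forall v, v \in x :: p -> exists2 h, H h & (d v h <= kappa)%R].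

(** ** Induced peripheral structure *)

Definition induced_peripheral_structure PP H OO : Prop :=
  conj_representatives H
    [set O | infinite_set O /\
       exists (g : G) (P : set G), PP P /\ O = H `&` conj_set g P] OO.

(** ** Word length and distortion *)

Definition expressible S (g : G) : pred nat := fun n =>
  `[< exists w : seq G, [/\ size w = n, \prod_(s <- w) s = g
        & forall s, s \in w -> S s \/ S s^-1] >].

(* The length of [g] in the alphabet [S] and inverses (0 if [g] is not in
   [gen S]). *)
Definition word_length S (g : G) : nat :=
  if pselect (exists n, expressible S g n) is left ex then ex_minn ex else 0%N.

(* The maximum of a finite set of naturals; 0 for the empty set and (junk) for
   infinite sets. *)
Definition max_nat (A : set nat) : nat := \big[maxn/0%N]_(n \in A) n.

(* Distortion of the subgroup [H], with generators [T], in the group generated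
   by [S]. *)
Definition distortion S H T (n : nat) : nat :=
  max_nat [set word_length T h | h in [set h | H h /\ (word_length S h <= n)%N]].

End Groups.

(** * Growth functions *)

(* The parts are allowed to be 0; the set of sums is finite as soon as
   f 0 = 0, which is the case for distortion functions. *)
Definition superadditive_closure (f : nat -> nat) (n : nat) : nat :=
  max_nat [set sumn (map f s) |
    s in [set s : seq nat | (0 < size s)%N /\ sumn s = n]].

Definition step_extension (R : realType) (f : nat -> nat) : R -> R :=
  fun r => (f (Num.truncn r))%:R%R.

Definition preceq_real (R : realType) (f g : R -> R) : Prop :=
  (exists2 C : R, 0 < C &
    forall r, 0 <= r -> f r <= C * g (C * r + C) + C * r + C)%R.

Definition preceq (R : realType) (f g : nat -> nat) : Prop :=
  preceq_real (@step_extension R f) (@step_extension R g).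

(* Main.v *)
Require Import Defs.
From mathcomp Require Import all_boot all_order all_algebra.
From mathcomp Require Import all_classical all_reals.
From mathcomp Require Import zify.
Local Open Scope classical_set_scope.
Set Implicit Arguments.
Unset Strict Implicit.
Unset Printing Implicit Defensive.
Import Order.TTheory GRing.Theory Num.Theory.

(** Let [K] be the fine hyperbolic graph and, for each peripheral subgroup [P],
    let [vp P] be a vertex with stabilizer [P].  Everything rests on one fact
    about the link of a vertex [v].  Call a neighbour [u] of [v] an entrance of
    [x] if it is the last vertex before [v] on a geodesic from [x] to [v], and
    call two neighbours of [v] close if they are joined by a short walk that
    avoids [v].  By fineness a neighbour has finitely many close neighbours.  If a
    quasigeodesic from [x] to [y] avoids [v], then the entrances of [x] and [y]
    are close ([entrance_quasigeodesic]): by hyperbolicity, geodesics from [x]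
    and [y] to [v] come near each other, or near the quasigeodesic, at a bounded
    distance from [v] but before [v].  Walks are also allowed to go through [v]
    by finitely many orbits of turns, so that orbit points can be joined by
    translates of fixed paths.  Geodesics of the relative Cayley graph give
    quasigeodesics of [K], because vertex stabilizers are finite or peripheral
    ([distX_le_orbit]), and such a geodesic fails to go around [v] only at an
    edge labelled by the stabilizer of [v], of which there is at most one
    ([through_unique]).

    Lower bound.  Let [O] be the intersection of [H] with the stabilizer of [v].
    A word in the generators of [H] that represents an element of [O] projects
    to a chain of entrances at [v] with close consecutive terms.  A term far from
    the first one forces a relative geodesic between points of [H] to cross the
    coset of [v], and by quasiconvexity that term is a bounded perturbation of an
    [O]-translate of one of finitely many neighbours.  So the chain moves in [O]
    by bounded steps: [O] is undistorted in [H] ([peripheral_undistorted]), and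
    its distortion in the peripheral subgroup is bounded by that of [H] in [G].
    The same argument shows that [OO] is finite ([OO_finite]).

    Upper bound.  Follow a relative geodesic from [1] to [h] in [H].  Its vertices
    are close to [H], so it cuts [h] into bounded pieces and pieces that lie, up
    to bounded factors, in the members of [OO]; the latter cost at most the
    distortion of their lengths in the peripheral subgroups ([peripheral_step]).
    The sum of those lengths is linear in the word length [n] of [h]
    ([total_chain_length]): project a word path of length [n] to each coset
    crossed; by Behrstock's inequality ([at_most_one_far]) each of its vertices
    projects far from both ends of at most one of these cosets, and only such
    vertices contribute.  The superadditive closure collects the pieces.

    The orbit of the base point has to avoid the vertices with infinite
    stabilizer.  To ensure this, a free orbit of leaves is attached to [K]. *)

(** * Growth functions *)

Lemma max_nat_ge (A : set nat) x : finite_set A -> A x -> x <= max_nat A.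
Proof.
move=> finA Ax; rewrite /max_nat fsbig_finite //.
by apply: leq_bigmax_seq => //; rewrite in_fset_set // inE.
Qed.

Lemma max_nat_le (A : set nat) m :
  finite_set A -> (forall x, A x -> x <= m) -> max_nat A <= m.
Proof.
move=> finA Am; rewrite /max_nat fsbig_finite //.
by apply/bigmax_leqP_seq => x + _; rewrite in_fset_set // inE => /Am.
Qed.

Lemma bounded_finite (A : set nat) m : (forall x, A x -> x <= m) -> finite_set A.
Proof.
by move=> Am; apply: (@sub_finite_set _ _ `I_m.+1) (finite_II _) => x /Am; rewrite /= ltnS.
Qed.

(** Uniform constants are obtained from this principle. *)
Lemma finite_bound (T : Type) (A : set T) (P : nat -> T -> Prop) :
  finite_set A -> (forall m n x, m <= n -> P m x -> P n x) ->
  (forall x, A x -> exists n, P n x) -> exists n, forall x, A x -> P n x.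
Proof.
move=> finA Pmono AP.
have [f fP] : {f : T -> nat & forall x, A x -> P (f x) x}.
  apply: (@choice _ _ (fun x n => A x -> P n x)) => x; have [Ax|nAx] := pselect (A x); last by exists 0.
  by have [n Pn] := AP x Ax; exists n.
exists (max_nat [set f x | x in A]) => x Ax; apply: Pmono (fP x Ax).
by apply: max_nat_ge; [apply: finite_image|exists x].
Qed.

(** [n] and [N] stand for the integer parts of [r] and of [C * r + C]. *)
Lemma preceqI (R : realType) (f g : nat -> nat) c :
  (forall n N, c * n + c <= N -> f n <= c * g N + c * n + c) -> preceq R f g.
Proof.
move=> fg; exists (c.+1%:R)%R; first by rewrite ltr0n.
move=> r r0; rewrite /step_extension.
set n := Num.truncn r; set N := Num.truncn _.
have nr : (n%:R <= r)%R by rewrite truncn_le.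
have cnN : c * n + c <= N.
  rewrite truncn_ge_nat ?addr_ge0 ?mulr_ge0 ?ler0n // natrD natrM.
  by rewrite lerD ?ler_pM ?ler0n // ?ler_nat.
apply: le_trans (_ : (c * g N + c * n + c)%:R <= _)%R; first by rewrite ler_nat fg.
rewrite !natrD !natrM !lerD ?ler_pM ?ler0n ?ler_nat //.
Qed.

(** Padding with one more part makes the sum equal to any larger [N]. *)
Lemma superadditive_closure_ge (f : nat -> nat) (s : seq nat) N :
  f 0 = 0 -> sumn s <= N -> sumn (map f s) <= superadditive_closure f N.
Proof.
move=> f0 sN; apply: (@leq_trans (sumn (map f (rcons s (N - sumn s))))).
  by rewrite map_rcons sumn_rcons leq_addr.
apply: max_nat_ge; last first.
  by exists (rcons s (N - sumn s)); rewrite //= size_rcons sumn_rcons; split=> //; lia.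
pose M := \max_(i < N.+1) f i.
have fM i : i <= N -> f i <= i * M.
  case: i => [|i] iN; first by rewrite f0.
  apply: (@leq_trans M); last by rewrite leq_pmull.
  by rewrite /M (@leq_bigmax _ (fun i : 'I_N.+1 => f i) (Ordinal (iN : i.+1 < N.+1))).
apply: (@bounded_finite _ (N * M)) => _ [r [_ rN] <-].
have rN' : sumn r <= N by rewrite rN.
apply: (@leq_trans (sumn r * M)); last by rewrite leq_mul2r rN' orbT.
elim: r {rN} rN' => //= i r IHr irN.
by rewrite mulnDl leq_add ?IHr ?fM //; lia.
Qed.

(** * Words and distortion *)

Section Words.
Variable G : groupType.
Implicit Types (S T H F : set G).
Local Open Scope group_scope.

Lemma subgroupE H : is_subgroup H <->
  [/\ H 1, forall x, H x -> H x^-1 & forall x y, H x -> H y -> H (x * y)].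
Proof.
split=> [sH|[H1 HV HM]].
  have [H1 _] := sH; split; first by move: H1; rewrite inE.
    by move=> x Hx; have := group_closedV sH (_ : x \in [in H]); rewrite !inE; apply.
  move=> x y Hx Hy; have := group_closedM sH (_ : x \in [in H]) (_ : y \in [in H]).
  by rewrite !inE; apply.
by split=> [|x y]; rewrite !inE // => Hx Hy; apply: HM => //; apply: HV.
Qed.

Definition word S n g := exists w : seq G,
  [/\ (size w <= n)%N, \prod_(s <- w) s = g & forall s, s \in w -> S s \/ S s^-1].

Lemma word_mono S m n g : (m <= n)%N -> word S m g -> word S n g.
Proof. by move=> mn [w [wm]]; exists w; split=> //; apply: leq_trans mn. Qed.

Lemma word1 S n : word S n 1.
Proof. by exists [::]; split=> //; rewrite big_nil. Qed.

Lemma wordM S m n g h : word S m g -> word S n h -> word S (m + n) (g * h).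
Proof.
move=> [w [wm <- wS]] [v [vn <- vS]]; exists (w ++ v).
rewrite size_cat leq_add // big_cat; split=> // s.
by rewrite mem_cat => /orP[/wS|/vS].
Qed.

Lemma wordV S n g : word S n g -> word S n g^-1.
Proof.
move=> [w [wn <- wS]]; elim: w n wn wS => [|s w IHw] n /= wn wS.
  by rewrite big_nil invg1; apply: word1.
case: n wn => // n wn; rewrite big_cons invgM -addn1; apply: wordM.
  by apply: IHw => // t tw; apply: wS; rewrite in_cons tw orbT.
exists [:: s^-1]; split=> //; first by rewrite big_seq1.
move=> t; rewrite inE => /eqP ->; rewrite invgK or_comm.
by apply: wS; rewrite mem_head.
Qed.

Lemma word_letter S s : S s -> word S 1 s.
Proof.
move=> Ss; exists [:: s]; split=> //; first by rewrite big_seq1.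
by move=> t; rewrite inE => /eqP ->; left.
Qed.

Lemma gen_subgroup S : is_subgroup (gen S).
Proof.
apply/subgroupE; split=> [|x Sx|x y Sx Sy] H [sH SH]; have [H1 HV HM] := (subgroupE H).1 sH.
- exact: H1.
- by apply: HV; apply: Sx; split.
- by apply: HM; [apply: Sx|apply: Sy]; split.
Qed.

Lemma gen_word S g : gen S g <-> exists n, word S n g.
Proof.
split=> [|[n [w [_ <- wS]]]]; last first.
  have [S1 SV SM] := (subgroupE (gen S)).1 (gen_subgroup S).
  have sub x : S x -> gen S x by move=> Sx H [_]; apply.
  elim: w wS => [|s w IHw] wS; first by rewrite big_nil.
  rewrite big_cons; apply: SM; last first.
    by apply: IHw => t tw; apply: wS; rewrite in_cons tw orbT.
  have [/sub //|/sub/SV] := wS s (mem_head _ _).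
  by rewrite invgK.
move=> /(_ [set g | exists n, word S n g]); apply.
split=> [|s Ss]; last by exists 1%N; apply: word_letter.
apply/subgroupE; split=> [|x [n xn]|x y [m xm] [n yn]].
- by exists 0%N; apply: word1.
- by exists n; apply: wordV.
- by exists (m + n)%N; apply: wordM.
Qed.

Lemma word_length_le S n g : word S n g -> (word_length S g <= n)%N.
Proof.
move=> [w [wn wg wS]]; rewrite /word_length; case: pselect => // ex.
case: ex_minnP => m _ /(_ (size w)) le_m; apply: leq_trans (wn); apply: le_m.
by apply/asboolP; exists w.
Qed.

Lemma word_length_word S g : gen S g -> word S (word_length S g) g.
Proof.
move=> /gen_word[n [w [wn wg wS]]]; rewrite /word_length.
case: pselect => [ex|[]]; last by exists (size w); apply/asboolP; exists w.
by case: ex_minnP => m /asboolP[v [vm vg vS]] _; exists v; rewrite vm.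
Qed.

Lemma word_finite S n : finite_set S -> finite_set [set g | word S n g].
Proof.
move=> finS; pose L := S `|` [set s^-1 | s in S].
have finL : finite_set L by rewrite finite_setU; split=> //; apply: finite_image.
elim: n => [|n IHn].
  apply: (@sub_finite_set _ _ [set 1]) (finite_set1 _) => g [w [w0 <- _]].
  by rewrite (size0nil (_ : size w = 0%N)) ?big_nil //; lia.
apply: (@sub_finite_set _ _ ([set 1] `|`
    \bigcup_(s in L) [set s * g | g in [set g | word S n g]])).
  move=> g [[|s w] [wn <- wS]]; first by left; rewrite big_nil.
  right; exists s; last first.
    exists (\prod_(t <- w) t); last by rewrite big_cons.
    by exists w; split=> // t tw; apply: wS; rewrite in_cons tw orbT.
  have [Ss|SVs] := wS s (mem_head _ _); [by left|right].
  by exists s^-1; rewrite ?invgK.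
rewrite finite_setU; split; first exact: finite_set1.
by apply: bigcup_finite => // s _; apply: finite_image.
Qed.

Lemma word_bound S F : finite_set F -> (forall g, F g -> gen S g) ->
  exists n, forall g, F g -> word S n g.
Proof.
move=> finF FS; apply: finite_bound finF _ _ => [m n g|g /FS/gen_word //].
exact: word_mono.
Qed.

Lemma word_sub S T n c g : (forall s, S s -> word T c s) -> word S n g ->
  word T (c * n) g.
Proof.
move=> ST [w [wn <- wS]]; apply: (@word_mono _ (c * size w)); first by rewrite leq_mul2l wn orbT.
elim: w wS {wn} => [|s w IHw] wS; first by rewrite big_nil; apply: word1.
rewrite big_cons mulnS; apply: wordM; last first.
  by apply: IHw => t tw; apply: wS; rewrite in_cons tw orbT.
have [/ST//|/ST/wordV] := wS s (mem_head _ _).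
by rewrite invgK.
Qed.

Lemma word_path S n g : word S n g -> exists m (a : nat -> G),
  [/\ (m <= n)%N, a 0%N = 1, a m = g, forall t, gen S (a t) &
      forall t, (t < m)%N -> S ((a t)^-1 * a t.+1) \/ S ((a t.+1)^-1 * a t)].
Proof.
move=> [w [wn wg wS]]; exists (size w), (fun t => \prod_(s <- take t w) s).
split=> //; first by rewrite take0 big_nil.
- by rewrite take_size.
- move=> t; apply/gen_word; exists (size w), (take t w); split=> //.
    by rewrite size_take_min; lia.
  by move=> s /mem_take; apply: wS.
move=> t tw; rewrite (take_nth 1 tw) -cats1 big_cat big_seq1 /=.
by rewrite mulKg invgM mulgVK; apply: wS; rewrite mem_nth.
Qed.

Section Distortion.
Variables S T H : set G.
Hypotheses (finS : finite_set S) (HS : forall h, H h -> gen S h).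
Hypothesis TH : finite_generating_set T H.

Let lengths n := [set word_length T h | h in [set h | H h /\ (word_length S h <= n)%N]].

Lemma lengths_finite n : finite_set (lengths n).
Proof.
apply: finite_image; apply: sub_finite_set (word_finite n finS) => h [Hh hn].
by apply: (word_mono hn (word_length_word (HS Hh))).
Qed.

Lemma distortion_word n h : H h -> word S n h -> word T (distortion S H T n) h.
Proof.
move=> Hh hn; apply: (@word_mono _ (word_length T h)); last first.
  by apply: word_length_word; have [_ ->] := TH.
apply: max_nat_ge; first exact: lengths_finite.
by exists h => //; split=> //; apply: word_length_le.
Qed.

Lemma distortion_le n m :
  (forall h, H h -> word S n h -> word T m h) -> (distortion S H T n <= m)%N.
Proof.
move=> nm; apply: max_nat_le; first exact: lengths_finite.
move=> _ [h [Hh hn] <-]; apply: word_length_le; apply: nm => //.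
by apply: (word_mono hn (word_length_word (HS Hh))).
Qed.

Lemma distortion_mono m n :
  (m <= n)%N -> (distortion S H T m <= distortion S H T n)%N.
Proof.
move=> mn; apply: distortion_le => h Hh hm.
by apply: distortion_word => //; apply: word_mono hm.
Qed.

Lemma distortion0 : distortion S H T 0 = 0%N.
Proof.
apply/eqP; rewrite -leqn0; apply: distortion_le => h _ [w [w0 <- _]].
rewrite (size0nil (_ : size w = 0%N)) ?big_nil; [exact: word1|lia].
Qed.

End Distortion.
End Words.

(** * The path metric of a connected graph *)

Section PathMetric.
Variables (V : eqType) (e : rel V).
Hypotheses (e_sym : symmetric e) (e_conn : connected_graph e).

Definition joined (x y : V) : pred nat :=
  fun n => `[< exists2 p, edge_path e x y p & size p = n >].

Lemma joined_ex x y : exists n, joined x y n.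
Proof.
have [_ /(_ x y)[p px]] := e_conn.
by exists (size p); apply/asboolP; exists p.
Qed.

Definition dist (x y : V) : nat := ex_minn (joined_ex x y).

Lemma geodesic_path x y : exists2 p, edge_path e x y p & size p = dist x y.
Proof. by rewrite /dist; case: ex_minnP => n /asboolP. Qed.

Lemma dist_le_size x y p : edge_path e x y p -> dist x y <= size p.
Proof.
move=> xpy; rewrite /dist; case: ex_minnP => n _; apply.
by apply/asboolP; exists p.
Qed.

Lemma size_geodesic x y p : geodesic e x y p -> size p = dist x y.
Proof.
case=> xpy minp; apply/eqP; rewrite eqn_leq dist_le_size // andbT.
by have [q xqy <-] := geodesic_path x y; apply: minp.
Qed.

Lemma dist_geodesic x y p : edge_path e x y p -> size p = dist x y ->
  geodesic e x y p.
Proof. by move=> xpy sp; split=> // q xqy; rewrite sp; apply: dist_le_size. Qed.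

Lemma edge_path_cat x y z p q :
  edge_path e x y p -> edge_path e y z q -> edge_path e x z (p ++ q).
Proof. by case=> xp <- [yq <-]; split; rewrite ?cat_path ?xp ?last_cat. Qed.

Lemma edge_path_rev x y p : edge_path e x y p ->
  edge_path e y x (rev (belast x p)).
Proof.
case=> xp <-; split.
  by rewrite rev_path; under eq_path => u v do rewrite e_sym.
case: p {xp} => //= a p.
by rewrite rev_cons last_rcons.
Qed.

Lemma dist_triangle y x z : dist x z <= dist x y + dist y z.
Proof.
have [p xp <-] := geodesic_path x y; have [q yq <-] := geodesic_path y z.
by rewrite -size_cat; apply: dist_le_size; apply: edge_path_cat yq.
Qed.

Lemma dist_morphism (f : V -> V) x y :
  (forall a b, e a b -> e (f a) (f b)) -> dist (f x) (f y) <= dist x y.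
Proof.
move=> fe; have [p [xp <-] <-] := geodesic_path x y.
rewrite -last_map -(size_map f); apply: dist_le_size; split=> //.
by elim: p x xp => //= z p IHp x /andP[/fe -> /IHp].
Qed.

Lemma dist_sym x y : dist x y = dist y x.
Proof.
suff le a b : dist a b <= dist b a by apply/eqP; rewrite eqn_leq !le.
have [p xp <-] := geodesic_path b a.
by rewrite -(size_belast b) -size_rev; apply: dist_le_size; apply: edge_path_rev.
Qed.

Lemma distxx x : dist x x = 0.
Proof. by apply/eqP; rewrite -leqn0; apply: (@dist_le_size x x [::]). Qed.

Lemma dist0_eq x y : dist x y = 0 -> x = y.
Proof. by have [p [_ <-] <-] := geodesic_path x y => /size0nil ->. Qed.

Lemma dist_edge x y : e x y -> dist x y <= 1.
Proof. by move=> xy; apply: (@dist_le_size x y [:: y]); split; rewrite /= ?xy. Qed.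

Lemma dist1_edge x y : dist x y = 1 -> e x y.
Proof.
have [p [xp <-] <-] := geodesic_path x y.
by case: p xp => [|z []] //= /andP[].
Qed.

(** [v] lies on a geodesic from [x] to [y]. *)
Definition btw x v y := dist x v + dist v y = dist x y.

Lemma btw_sym x v y : btw x v y -> btw y v x.
Proof. by rewrite /btw (dist_sym y v) (dist_sym v x) (dist_sym y x); lia. Qed.

Lemma btw_l x y : btw x x y. Proof. by rewrite /btw distxx. Qed.
Lemma btw_r x y : btw x y y. Proof. by rewrite /btw distxx addn0. Qed.

Lemma btw_refl x v : btw x v x -> v = x.
Proof.
by rewrite /btw distxx => xv; symmetry; apply: dist0_eq; lia.
Qed.

Lemma btw_trans x v y z : btw x v y -> btw x y z -> btw x v z.
Proof.
rewrite /btw => xvy xyz.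
by have := dist_triangle y v z; have := dist_triangle v x z; lia.
Qed.

Lemma dist_chain M (c : nat -> V) i j : i <= j ->
    (forall t, i <= t < j -> dist (c t) (c t.+1) <= M) ->
  dist (c i) (c j) <= M * (j - i).
Proof.
elim: j => [|j IHj] ij cM.
  have i0 : i = 0 by lia.
  by rewrite i0 distxx.
have [->|ltij] := eqVneq i j.+1; first by rewrite distxx.
have ij' : i <= j by lia.
have cij : dist (c i) (c j) <= M * (j - i).
  by apply: IHj => // t tij; apply: cM; lia.
have := dist_triangle (c j) (c i) (c j.+1); have := cM j ltac:(lia).
by rewrite subSn // mulnS; lia.
Qed.

Lemma dist_path_nth x p i j : path e x p -> i <= j -> j <= size p ->
  dist (nth x (x :: p) i) (nth x (x :: p) j) <= j - i.
Proof.
move=> /(pathP x) ep ij jp; rewrite -[j - i]mul1n.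
apply: dist_chain => // t tij; apply/dist_edge/ep; lia.
Qed.

Lemma geodesic_point x y p i : geodesic e x y p -> i <= size p ->
  dist x (nth x (x :: p) i) = i /\ dist (nth x (x :: p) i) y = size p - i.
Proof.
move=> gp ip; have sp := size_geodesic gp; case: gp => -[xp py] _.
have := dist_path_nth xp (leq0n i) ip; have := dist_path_nth xp ip (leqnn _).
rewrite [nth x (x :: p) 0]/= -last_nth py.
by have := dist_triangle (nth x (x :: p) i) x y; lia.
Qed.

Lemma geodesic_btw x y p v : geodesic e x y p -> v \in x :: p -> btw x v y.
Proof.
move=> gp /(nthP x)[i /= ip <-].
have [] := geodesic_point gp (_ : i <= size p); first by lia.
by rewrite /btw -(size_geodesic gp) => -> ->; lia.
Qed.

Lemma btw_at x y n : n <= dist x y -> exists2 z, btw x z y & dist x z = n.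
Proof.
have [p xpy sp] := geodesic_path x y; rewrite -sp => np.
have gp := dist_geodesic xpy sp; exists (nth x (x :: p) n).
  by apply: geodesic_btw gp _; rewrite mem_nth.
by have [] := geodesic_point gp np.
Qed.

Lemma geodesic_parametrization x y : exists c : nat -> V,
  [/\ c 0 = x, c (dist x y) = y,
      forall i, i <= dist x y -> btw x (c i) y
    & forall i j, i <= j -> j <= dist x y -> dist (c i) (c j) = j - i].
Proof.
have [p xpy sp] := geodesic_path x y.
have gp := dist_geodesic xpy sp; exists (fun i => nth x (x :: p) i).
have last_p : nth x (x :: p) (dist x y) = y.
  by rewrite -sp -last_nth; case: xpy.
split=> [||i iy|i j ij jy]; rewrite ?last_p //.
  apply: (geodesic_btw gp); apply: mem_nth; rewrite /= sp; lia.
set a := nth _ _ i; set b := nth _ _ j.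
have [xa ay] : dist x a = i /\ dist a y = size p - i.
  by apply: geodesic_point gp _; lia.
have [xb yb] : dist x b = j /\ dist b y = size p - j.
  by apply: geodesic_point gp _; lia.
have [xp _] := xpy; have jp : j <= size p by rewrite sp.
have := dist_path_nth xp ij jp; rewrite -/a -/b.
by have := dist_triangle a x b; lia.
Qed.

(** * Stability of quasigeodesics *)

Lemma geodesic_cat x b y p q : edge_path e x b p -> edge_path e b y q ->
  size p = dist x b -> size q = dist b y -> btw x b y -> geodesic e x y (p ++ q).
Proof.
move=> xb yb sp sq xby; apply: dist_geodesic; first exact: edge_path_cat yb.
by rewrite size_cat sp sq.
Qed.

(** Slimness in terms of distances.  The geodesic from [y] to [z] can be chosen
    through any given [b]; the conclusion remembers on which side of [b] the
    nearby point lies. *)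
Definition thin delta := forall x y z v b, btw x v y -> btw y b z ->
  exists2 t, dist v t <= delta & [\/ btw y t b, btw b t z | btw z t x].

Lemma slim_thin delta : slim_triangles e delta -> thin delta.
Proof.
move=> slim x y z v b xvy ybz.
have [p1 xv1 sp1] := geodesic_path x v; have [p2 xv2 sp2] := geodesic_path v y.
have [q1 yb1 sq1] := geodesic_path y b; have [q2 yb2 sq2] := geodesic_path b z.
have [r zx sr] := geodesic_path z x.
have gp := geodesic_cat xv1 xv2 sp1 sp2 xvy.
have gq := geodesic_cat yb1 yb2 sq1 sq2 ybz.
have gr := dist_geodesic zx sr.
have vp : v \in x :: p1 ++ p2.
  by have [_ <-] := xv1; rewrite -cat_cons mem_cat mem_last.
have [t [s [tqr vs ss]]] := slim _ _ _ _ _ _ gp gq gr _ vp.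
exists t; first exact: leq_trans (dist_le_size vs) ss.
move: tqr; rewrite mem_cat => /orP[|tr]; last first.
  by apply: Or33; apply: geodesic_btw gr tr.
rewrite -cat_cons mem_cat => /orP[tq|tq].
  by apply: Or31; apply: geodesic_btw tq; apply: dist_geodesic.
apply: Or32; apply: (@geodesic_btw _ _ q2); first exact: dist_geodesic.
by rewrite in_cons tq orbT.
Qed.

Variable delta : nat.
Hypothesis e_thin : thin delta.

Lemma slim_btw x y z v : btw x v y ->
  exists2 t, dist v t <= delta & btw y t z \/ btw z t x.
Proof.
move=> xvy; have [t vt tE] := e_thin xvy (btw_l y z).
exists t => //; case: tE => [yty|ytz|ztx]; [left|by left|by right].
by rewrite (btw_refl yty); apply: btw_l.
Qed.

(** Bisecting a sequence of [2 ^ N] jumps loses one slimness constant at each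
    of the [N] scales. *)
Lemma near_jump_sequence M N (c : nat -> V) i j v : i <= j -> j - i <= 2 ^ N ->
    (forall t, i <= t < j -> dist (c t) (c t.+1) <= M) ->
    btw (c i) v (c j) ->
  exists2 t, i <= t <= j & dist v (c t) <= delta * N + M.
Proof.
elim: N i j v => [|N IHN] i j v ij len cM civ.
  exists i; first by rewrite leqnn.
  have cij := dist_chain ij cM; rewrite dist_sym.
  have : M * (j - i) <= M * 1 by rewrite leq_mul2l len orbT.
  by move: civ; rewrite /btw; lia.
have [small|big] := leqP (j - i) (2 ^ N).
  have [t tij vt] := IHN i j v ij small cM civ.
  by exists t => //; apply: leq_trans vt _; rewrite mulnS; lia.
have pow : 2 ^ N.+1 = 2 ^ N + 2 ^ N by rewrite expnS mul2n addnn.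
pose m := i + 2 ^ N.
have [t vt tE] := slim_btw (c m) civ.
have [s ms tcs] : exists2 s, i <= s <= j & dist t (c s) <= delta * N + M.
  case: tE => [/btw_sym|/btw_sym] ctm.
    have [||||s sij ts] := IHN m j t; rewrite /m //; try lia.
      by move=> s sij; apply: cM; lia.
    by exists s; lia.
  have [||||s sij ts] := IHN i m t; rewrite /m //; try lia.
    by move=> s sij; apply: cM; lia.
  by exists s; lia.
by exists s => //; have := dist_triangle t v (c s); rewrite mulnS; lia.
Qed.

(** Sequences of jumps rather than edge paths, so that orbits of points can be
    used directly; one constant [C] serves for the size of the jumps and for
    both constants of the quasi-isometric embedding. *)
Definition quasigeodesic C (c : nat -> V) k :=
  (forall t, t < k -> dist (c t) (c t.+1) <= C) /\
  (forall i j, i <= j -> j <= k -> j - i <= C * dist (c i) (c j) + C).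

Lemma quasigeodesic_mono C C' c k : C <= C' ->
  quasigeodesic C c k -> quasigeodesic C' c k.
Proof.
move=> CC' [jump qi]; split=> [t tk|i j ij jk].
  exact: leq_trans (jump t tk) CC'.
by apply: leq_trans (qi i j ij jk) _; rewrite leq_add ?leq_mul.
Qed.

Lemma linear_lt_exp a b : exists N0, forall N, N0 <= N -> a * N + b <= 2 ^ N.
Proof.
(* [2 ^ N = 2 ^ (N - h) * 2 ^ h] with both factors growing at least linearly. *)
exists ((a + b + 1) * 4) => N hN.
have [h NE] : exists h, h + h <= N <= h + h + 1.
  by exists N./2; have := odd_double_half N; case: (odd N); lia.
have abh : 2 * (a + b + 1) <= h by lia.
have h2 : h < 2 ^ h by apply: ltn_expl.
have : h.+1 * h.+1 <= 2 ^ h * 2 ^ h by apply: leq_mul.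
rewrite -expnD => sq; have : 2 ^ (h + h) <= 2 ^ N by rewrite leq_exp2l //; lia.
move=> le1; apply: leq_trans le1; apply: leq_trans sq.
have : a * N <= a * (h + h + 1) by rewrite leq_mul2l; lia.
have : 2 * (a + b + 1) * h <= h * h by rewrite leq_mul2r abh orbT.
nia.
Qed.

(** Let [v] be a point of the geodesic at maximal distance [D] from the
    sequence.  Points of the geodesic at distance [2 * D] on either side of [v]
    are [D]-close to terms of the sequence whose indices differ by a linear
    function of [D]; slimness then brings the sequence within a logarithmic
    function of [D] of [v]. *)
Lemma quasigeodesic_near_geodesic C : exists R, forall c k v,
  quasigeodesic C c k -> btw (c 0) v (c k) ->
  exists2 t, t <= k & dist v (c t) <= R.
Proof.
pose L N := 2 * delta + delta * N + C.
have [N0 N0P] := linear_lt_exp (6 * C * delta) (6 * C * (2 * delta + delta + C) + C).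
exists (L N0) => c k v qc cvk; have [jump qi] := qc.
pose far D := `[< exists2 w, btw (c 0) w (c k) & forall t, t <= k -> D <= dist w (c t) >].
have far0 : exists D, far D by exists 0; apply/asboolP; exists v.
have far_le D : far D -> D <= dist (c 0) (c k).
  by move=> /asboolP[w cwk /(_ 0 (leq0n k))]; rewrite dist_sym -cwk; lia.
case: (ex_maxnP far0 far_le) => D /asboolP[w cwk Dw] maxD.
have close_D u : btw (c 0) u (c k) -> exists2 t, t <= k & dist u (c t) <= D.
  move=> cuk; apply: contrapT => no_t.
  suff /maxD : far D.+1 by rewrite ltnn.
  apply/asboolP; exists u => // t tk; rewrite ltnNge; apply/negP => ut.
  by apply: no_t; exists t.
suff DL : D <= L N0.
  by have [t tk vt] := close_D v cvk; exists t => //; apply: leq_trans DL.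
(* A point [y] between [w] and an end, at distance at most [2 * D] from [w],
   joined to the sequence by a geodesic that stays at distance [D] from [w]. *)
have side x : btw (c 0) x (c k) -> (x = c 0 \/ x = c k) ->
    (forall y, btw x y w -> btw (c 0) y (c k)) ->
  exists y i, [/\ i <= k, btw x y w, dist y w <= 2 * D, dist y (c i) <= D
              & forall t, btw y t (c i) -> D <= dist w t].
  move=> cxk xE sub.
  have [short|long] := leqP (dist x w) (2 * D).
    have [i ik xi] : exists2 i, i <= k & x = c i.
      by case: xE => ->; [exists 0|exists k].
    exists x, i; split=> //; first exact: btw_l.
      by rewrite xi distxx.
    by move=> t; rewrite -xi => /btw_refl ->; rewrite xi; apply: Dw.
  have [y xyw xy] := @btw_at x w (dist x w - 2 * D) (leq_subr _ _).
  have [i ik yi] := close_D y (sub y xyw).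
  have yw : dist y w = 2 * D by move: xyw; rewrite /btw; lia.
  exists y, i; split=> //; first by rewrite yw.
  move=> t yti; have := dist_triangle t y w; rewrite (dist_sym t w).
  by move: yti; rewrite /btw; lia.
have [|z0 z0w|y [i [ik yw dyw dyi Dy]]] := side (c 0) (btw_l _ _).
- by left.
- exact: btw_trans z0w cwk.
have [|z0 z0w|z [j [jk zw dzw dzj Dz]]] := side (c k) (btw_r _ _).
- by right.
- by apply: btw_sym; apply: btw_trans z0w (btw_sym cwk).
have ywz : btw y w z.
  move: yw zw cwk; rewrite /btw.
  have := dist_triangle y (c 0) (c k); have := dist_triangle z y (c k).
  have := dist_triangle w y z; rewrite (dist_sym (c k) z) (dist_sym (c k) w).
  by rewrite (dist_sym w z); lia.
have DN N : 6 * C * D + C <= 2 ^ N -> D <= L N.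
  move=> ND; have cij : dist (c i) (c j) <= 6 * D.
    have := dist_triangle y (c i) (c j); have := dist_triangle w y (c j).
    have := dist_triangle z w (c j); rewrite (dist_sym (c i) y) (dist_sym w z).
    by lia.
  have len i' j' : i' <= j' -> j' <= k -> dist (c i') (c j') <= 6 * D ->
      j' - i' <= 2 ^ N.
    move=> ij' jk' cij'; apply: leq_trans (qi i' j' ij' jk') _.
    by apply: leq_trans ND; rewrite leq_add2r -mulnA mulnCA leq_mul2l cij' orbT.
  have [t wt tE] := slim_btw (c i) ywz.
  case: tE => [zti|/btw_sym/Dy]; last by rewrite /L; lia.
  have [s ts sE] := slim_btw (c j) zti.
  have ws : dist w s <= 2 * delta by have := dist_triangle t w s; lia.
  case: sE => [cis|/btw_sym/Dz]; last by rewrite /L; lia.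
  have [r rk sr] : exists2 r, r <= k & dist s (c r) <= delta * N + C.
    have [ij|/ltnW ji] := leqP i j.
      have cM r : i <= r < j -> dist (c r) (c r.+1) <= C.
        by move=> rij; apply: jump; lia.
      have [r rij sr] := near_jump_sequence ij (len i j ij jk cij) cM cis.
      by exists r; lia.
    have cji : dist (c j) (c i) <= 6 * D by rewrite dist_sym.
    have cM r : j <= r < i -> dist (c r) (c r.+1) <= C.
      by move=> rji; apply: jump; lia.
    have [r rji sr] := near_jump_sequence ji (len j i ji ik cji) cM (btw_sym cis).
    by exists r; lia.
  by have := Dw r rk; have := dist_triangle s w (c r); rewrite /L; lia.
(* For the least [N] with [6 * C * D + C <= 2 ^ N] the bound [D <= L N] shows
   that [2 ^ N.-1] is smaller than a linear function of [N], so [N <= N0]. *)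
have [N NP minN] : exists2 N, 6 * C * D + C <= 2 ^ N &
    forall N', 6 * C * D + C <= 2 ^ N' -> N <= N'.
  have exN : exists N, 6 * C * D + C <= 2 ^ N.
    by exists (6 * C * D + C); rewrite ltnW // ltn_expl.
  by case: (ex_minnP exN) => N; exists N.
apply: leq_trans (DN N NP) _; rewrite /L !leq_add2r leq_add2l leq_mul2l.
apply/orP; right; rewrite leqNgt; apply/negP => N0N.
case: N NP minN N0N => // N NP minN N0N.
have DLN := DN _ NP; have le2 := N0P N ltac:(lia).
suff /minN : 6 * C * D + C <= 2 ^ N by rewrite ltnn.
apply: leq_trans le2; rewrite addnA leq_add2r -!mulnA -!mulnDr.
by rewrite !leq_mul2l /=; move: DLN; rewrite /L mulnS; lia.
Qed.
(** * Walks around a vertex *)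

Variable turn : V -> V -> V -> Prop.
Hypothesis turn_sym : forall v x y, turn v x y -> turn v y x.

(** Walks that avoid [v], except that they may cross [v] by an allowed turn, which
    counts as one step.  Their end points differ from [v], so they can be
    concatenated without creating new turns. *)
Definition detour_step v x y :=
  [/\ x <> v, y <> v & e x y \/ [/\ e x v, e v y & turn v x y]].

Inductive detour v : nat -> V -> V -> Prop :=
| detour0 n x : x <> v -> detour v n x x
| detourS n x y z : detour_step v x y -> detour v n y z -> detour v n.+1 x z.

Lemma detour_neq v n x y : detour v n x y -> x <> v /\ y <> v.
Proof. by elim=> // m a b c [] ? ? ? ? []. Qed.

Lemma detour_mono v m n x y : m <= n -> detour v m x y -> detour v n x y.
Proof.
move=> + xy; elim: xy n => [k a av|k a b c ab _ IH] n kn; first exact: detour0.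
by case: n kn => // n kn; apply: detourS ab _; apply: IH.
Qed.

Lemma detour_trans y v m n x z :
  detour v m x y -> detour v n y z -> detour v (m + n) x z.
Proof.
elim=> [k a av|k a b c ab _ IH] cz; first by apply: detour_mono cz; lia.
by rewrite addSn; apply: detourS ab (IH cz).
Qed.

Lemma detour_step_sym v x y : detour_step v x y -> detour_step v y x.
Proof.
case=> xv yv xy; split=> //; rewrite e_sym; case: xy => [|[xv' vy xvy]].
  by left.
by right; rewrite e_sym vy e_sym xv'; split=> //; apply: turn_sym.
Qed.

Lemma detour1 v x y : detour_step v x y -> detour v 1 x y.
Proof. by move=> xy; apply: detourS (xy) _; apply: detour0; case: xy. Qed.

Lemma detour_sym v n x y : detour v n x y -> detour v n y x.
Proof.
elim=> [k a av|k a b c ab _ IH]; first exact: detour0.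
by rewrite -addn1; apply: detour_trans IH (detour1 (detour_step_sym ab)).
Qed.

(** Such a geodesic is too short to reach [v]. *)
Lemma detour_geodesic v x y : dist x y < dist x v -> detour v (dist x y) x y.
Proof.
have [n xyn] : exists n, dist x y = n by exists (dist x y).
rewrite xyn; elim: n y xyn => [|n IHn] y xyn nv.
  by rewrite -(dist0_eq xyn); apply: detour0 => xv; move: nv; rewrite xv distxx.
have [z xzy xz] : exists2 z, btw x z y & dist x z = n by apply: btw_at; lia.
have zy : e z y by apply: dist1_edge; move: xzy; rewrite /btw; lia.
rewrite -addn1; apply: detour_trans (IHn z xz ltac:(lia)) _.
apply: detour1; split; last by left.
  by move=> zv; rewrite zv in xz; lia.
by move=> yv; rewrite yv in xyn; lia.
Qed.

(** [u] is the last vertex before [v] on some geodesic from [x] to [v]. *)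
Definition entrance v x u := e u v /\ (dist x u).+1 = dist x v.

Lemma entrance_ex v x : x <> v -> exists u, entrance v x u.
Proof.
move=> xv; have xv_gt0 : 0 < dist x v by rewrite lt0n; apply/eqP => /dist0_eq.
have [u xuv xu] := @btw_at x v (dist x v).-1 (leq_pred _).
by exists u; split; [apply: dist1_edge; move: xuv; rewrite /btw|]; lia.
Qed.

Lemma entrance_btw v x u : entrance v x u -> btw x u v.
Proof.
case=> uv xu; have := dist_edge uv; have := dist_triangle u x v.
by rewrite /btw; lia.
Qed.

Lemma entrance_sub v x z u : btw x z u -> entrance v x u -> entrance v z u.
Proof.
move=> xzu [uv xu]; split=> //; move: xzu xu; rewrite /btw => xzu xu.
have := dist_edge uv; have := dist_triangle u z v; have := dist_triangle z x v.
by lia.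
Qed.

Lemma detour_entrance v x u : entrance v x u -> detour v (dist x v) x u.
Proof. by case=> uv xu; apply: detour_mono (detour_geodesic _); lia. Qed.

(** The side [x] of the triangle [x], [y], [v]: the point of the geodesic from
    [x] to [v] at distance about [R + delta] from [v] is too far from [v] for
    the short geodesics given by slimness to meet [v]. *)
Lemma entrance_slim R v x y u u' (X : V -> Prop) : X x ->
    (forall t, btw x t y -> exists2 p, X p & dist t p <= R) ->
    entrance v x u -> entrance v y u' ->
  let D := R + delta + 1 in
  detour v (4 * D) u u' \/
  exists2 p, X p & detour v (2 * D) u p /\ dist p v <= 2 * D.
Proof.
move=> Xx XR xu yu' D.
have [xv|vx] := leqP (dist x v) D.
  right; exists x => //; split; last by lia.
  by apply: detour_mono (detour_sym (detour_entrance xu)); lia.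
have [a xau au] : exists2 a, btw x a u & dist a v = D.
  have [|a uax ua] := @btw_at u x (D - 1).
    by have [_ xu1] := xu; rewrite dist_sym; lia.
  exists a; first exact: btw_sym.
  have [_ <-] := entrance_sub (btw_sym uax) xu.
  by rewrite dist_sym ua /D; lia.
have [uv aE] := entrance_sub xau xu.
have ua : detour v D u a.
  by apply: detour_sym; rewrite -au; apply: detour_entrance; split.
have xav : btw x a v by apply: btw_trans xau (entrance_btw xu).
have [t at_ tE] :=
  e_thin xav (btw_sym (entrance_btw yu') : btw v u' y).
have [t_near|t_far] : (btw u' t y \/ btw y t x) \/ t = v.
  case: tE => [vtu'||]; [|by left; left|by left; right].
  have [uv' _] := yu'; have := dist_edge uv'; rewrite dist_sym.
  move: vtu'; rewrite /btw => vtu' le1.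
  have [/dist0_eq ->|vt] := eqVneq (dist v t) 0; first by right.
  by left; left; rewrite (@dist0_eq t u'); [apply: btw_l|lia].
- have adt : detour v delta a t.
    by apply: (detour_mono at_ (detour_geodesic _)); rewrite au /D; lia.
  case: t_near => [u'ty|ytx].
    left; have tu' := entrance_sub (btw_sym u'ty) yu'.
    have tv : dist t v <= D + delta.
      by have := dist_triangle a t v; rewrite (dist_sym t a); lia.
    apply: detour_mono (detour_trans ua (detour_trans adt (detour_entrance tu'))).
    move: tv; rewrite /D; lia.
  right; have [p Xp tp] := XR t (btw_sym ytx).
  have ap : dist a p <= delta + R by have := dist_triangle t a p; lia.
  exists p => //; split; last first.
    by have := dist_triangle a p v; rewrite (dist_sym p a) au /D; lia.
  apply: detour_mono (detour_trans ua (detour_geodesic _)); rewrite ?au /D; lia.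
- by move: at_; rewrite t_far au /D; lia.
Qed.

(** From either end, [entrance_slim] leads to the entrance of the other end or
    to a term of the quasigeodesic at bounded distance from [v].  In the latter
    case for both ends, the two terms are at bounded distance from each other, so
    boundedly many jumps of the quasigeodesic join them around [v]. *)
Lemma entrance_quasigeodesic C : exists N, forall v c k u u',
  quasigeodesic C c k -> (forall t, t < k -> detour v C (c t) (c t.+1)) ->
  entrance v (c 0) u -> entrance v (c k) u' -> detour v N u u'.
Proof.
have [R near] := quasigeodesic_near_geodesic C.
pose D := R + delta + 1; exists (4 * D + C * (C * (4 * D) + C)) => v c k u u' qc cv xu yu'.
have [jump qi] := qc; pose X p := exists2 t, t <= k & p = c t.
have XR t : btw (c 0) t (c k) -> exists2 p, X p & dist t p <= R.
  by move=> /(near _ _ _ qc)[i ik ti]; exists (c i) => //; exists i.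
have X0 : X (c 0) by exists 0.
have Xk : X (c k) by exists k.
have XR' t : btw (c k) t (c 0) -> exists2 p, X p & dist t p <= R.
  by move=> /btw_sym; apply: XR.
have [d|[p [i ik pi] [up pv]]] := entrance_slim X0 XR xu yu'.
  by apply: detour_mono d; rewrite /D; lia.
have [d|[q [j jk qj] [uq qv]]] := entrance_slim Xk XR' yu' xu.
  by apply: detour_sym; apply: detour_mono d; rewrite /D; lia.
have along a b : a <= b -> b <= k -> c a <> v -> detour v (C * (b - a)) (c a) (c b).
  move=> ab bk av; elim: b ab bk => [|b IHb] ab bk.
    have a0 : a = 0 by lia.
    by rewrite a0 in av *; apply: detour0.
  have [<-|ab'] := eqVneq a b.+1; first exact: detour0.
  rewrite subSn; last by lia.
  by rewrite mulnS addnC; apply: detour_trans (IHb _ _) (cv b _); lia.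
have pq : dist p q <= 4 * D by have := dist_triangle v p q; rewrite (dist_sym v q) /D; lia.
have [_ pv'] := detour_neq up; have [_ qv'] := detour_neq uq.
have len a b : a <= b -> b <= k -> dist (c a) (c b) <= 4 * D -> b - a <= C * (4 * D) + C.
  move=> ab bk cab; apply: leq_trans (qi a b ab bk) _.
  by rewrite leq_add2r leq_mul2l cab orbT.
have pq' : detour v (C * (C * (4 * D) + C)) p q.
  rewrite pi qj in pq pv' qv' *.
  have [ij|/ltnW ji] := leqP i j.
    by apply: detour_mono (along i j ij jk pv'); rewrite leq_mul2l len ?orbT.
  apply: detour_sym; apply: detour_mono (along j i ji ik qv').
  by rewrite leq_mul2l len ?orbT // dist_sym.
apply: detour_mono (detour_trans up (detour_trans pq' (detour_sym uq))).
by rewrite /D; lia.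
Qed.

(** A geodesic that avoids [v] is a quasigeodesic that goes around [v]. *)
Lemma entrance_btw_or_detour : exists N, forall v x y u u',
  entrance v x u -> entrance v y u' -> btw x v y \/ detour v N u u'.
Proof.
have [N NP] := entrance_quasigeodesic 1; exists N => v x y u u' xu yu'.
have [|nxvy] := pselect (btw x v y); [by left|right].
have [c [c0 ck cb cd]] := geodesic_parametrization x y.
have cv i : i <= dist x y -> c i <> v by move=> /cb + civ; rewrite civ.
apply: (NP v c (dist x y)); rewrite ?c0 ?ck //.
  split=> [t tk|i j ij jk]; first by rewrite cd //; lia.
  by rewrite cd //; lia.
move=> t tk; apply: detour1; split; try by apply: cv; lia.
by left; apply: dist1_edge; rewrite cd //; lia.
Qed.

(** ** Local finiteness of the link of a vertex *)

Definition link_sphere v u n : set V := [set u' | e v u' /\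
  exists p, [/\ path e u p, last u p = u', v \notin u :: p & size p <= n]].

Definition fine_links := forall v u n, e u v -> finite_set (link_sphere v u n).

(** A simple path from [u] to [u'] avoiding [v] closes up to a circuit through
    the edge from [v] to [u]. *)
Lemma fine_graph_links : fine_graph e -> fine_links.
Proof.
move=> e_fine v u n uv; have vu : e v u by rewrite e_sym.
apply: (@sub_finite_set _ _ (\bigcup_(m in `I_n.+3)
  [set last v c | c in [set c | [/\ ucycle e c, size c = m & next c v = u \/ next c u = v]]])).
  move=> u' [vu' [p [up pu' vp sp]]]; move: vu'; rewrite -{}pu' => vu'.
  case/shortenP: up vu' => q uq q_uniq qp vu'.
  have sq : size q <= n.
    by apply: leq_trans sp; apply: uniq_leq_size qp; case/andP: q_uniq.
  exists (size q).+2; first by rewrite /=; lia.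
  exists [:: v, u & q] => //=; split=> //=; last by left; rewrite eqxx.
  apply/andP; split; first by rewrite /= vu rcons_path uq e_sym.
  rewrite cons_uniq q_uniq andbT; apply: contra vp; rewrite !in_cons.
  by case: (v == u) => //= /qp.
apply: bigcup_finite; first exact: finite_II.
by move=> m _; apply: finite_image; apply: e_fine.
Qed.

Hypothesis e_fine : fine_links.
Hypothesis turn_finite :
  forall v x, e x v -> finite_set [set y | e v y /\ turn v x y].

Definition link_move v n u u' :=
  link_sphere v u n u' \/ (e v u' /\ turn v u u').

Fixpoint link_ball v n u k : set V :=
  if k is k'.+1 then
    \bigcup_(w in link_ball v n u k') [set u' | link_move v n w u']
  else [set u].

Lemma link_ball_adj v n u k w : e v u -> link_ball v n u k w -> e v w.
Proof. by case: k => [|k] vu /= => [->|[w' _ [][]]]. Qed.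

Lemma link_ball_finite v n u k : e v u -> finite_set (link_ball v n u k).
Proof.
move=> vu; elim: k => [|k IHk] /=; first exact: finite_set1.
apply: bigcup_finite IHk _ => w /(link_ball_adj vu) vw.
have wv : e w v by rewrite e_sym.
rewrite (_ : mkset _ = link_sphere v w n `|` [set u' | e v u' /\ turn v w u']) //.
by rewrite finite_setU; split; [exact: e_fine|exact: turn_finite].
Qed.

(** A detour is cut by its turns into paths avoiding [v]; both ends of a turn are
    neighbours of [v], so these pieces are moves in the link. *)
Lemma detour_link_ball v n u m x z k w p : detour v m x z ->
    link_ball v n u k w -> path e w p -> last w p = x -> v \notin w :: p ->
    size p + m <= n ->
  exists2 k', k' <= k + m.*2 & exists w' p', [/\ link_ball v n u k' w',
    path e w' p', last w' p' = z & v \notin w' :: p' /\ size p' <= n].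
Proof.
move=> xz; elim: xz k w p => {m x z} [m x xv|m x y z xy yz IH] k w p ukw wp px vp sp.
  by exists k; [lia|exists w, p; split=> //; split=> //; lia].
case: xy => xv yv [xy|[xv' vy xvy]].
  have [||||k' kk' H] := IH k w (rcons p y) ukw.
  - by rewrite rcons_path wp px.
  - by rewrite last_rcons.
  - rewrite -rcons_cons mem_rcons in_cons negb_or vp andbT.
    by apply/eqP => vy; apply: yv.
  - by rewrite size_rcons; lia.
  by exists k' => //; rewrite doubleS; lia.
have vy' : v \notin [:: y] by rewrite inE; apply/eqP => vyE; apply: yv.
have [|//|//|//|/=|k' kk' H] := IH k.+2 y [::]; last 2 first.
- by lia.
- by exists k' => //; rewrite doubleS; lia.
exists x; last by right.
exists w => //; left; split; first by rewrite e_sym.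
by exists p; split=> //; lia.
Qed.

Lemma link_finite v u n : e u v ->
  finite_set [set u' | e u' v /\ detour v n u u'].
Proof.
move=> uv; have vu : e v u by rewrite e_sym.
apply: (@sub_finite_set _ _ (\bigcup_(k in `I_(n.*2).+2) link_ball v n u k)).
  move=> u' [u'v uu']; have [uv' u'v'] := detour_neq uu'.
  have [||//|||k kn [w [p [uw wp pu' [vp sp]]]]] :=
    @detour_link_ball v n u n u u' 0 u [::] uu' => //.
    by rewrite inE; apply/eqP => vuE; apply: uv'.
  exists k.+1; first by rewrite /=; lia.
  exists w => //; left; split; first by rewrite e_sym.
  by exists p.
by apply: bigcup_finite => [|k _]; [apply: finite_II|apply: link_ball_finite].
Qed.

End PathMetric.

(** * Actions on fine hyperbolic graphs *)

Section Action.
Variables (G : groupType) (V : eqType) (e : rel V) (act : G -> V -> V).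
Hypotheses (e_sym : symmetric e) (e_irr : irreflexive e).
Hypothesis actP : graph_action e act.
Hypothesis e_conn : connected_graph e.
Variable delta : nat.
Hypothesis slim : thin e_conn delta.
Hypothesis e_fine : fine_links e.
Hypothesis edge_stab_finite :
  forall x y, e x y -> finite_set (edge_stabilizer act x y).
Hypothesis edge_orbits : finitely_many_edge_orbits e act.

Local Open Scope group_scope.
Local Notation stab := (vertex_stabilizer act).
Local Notation d := (dist e_conn).
Local Notation between := (btw e_conn).
Local Notation ent := (entrance e_conn).

Lemma act1 v : act 1 v = v. Proof. by case: actP. Qed.
Lemma actM g h v : act (g * h) v = act g (act h v). Proof. by case: actP. Qed.
Lemma act_edge g x y : e (act g x) (act g y) = e x y. Proof. by case: actP. Qed.

Lemma actK g v : act g^-1 (act g v) = v.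
Proof. by rewrite -actM mulVg act1. Qed.

Lemma actVK g v : act g (act g^-1 v) = v.
Proof. by rewrite -actM mulgV act1. Qed.

Lemma act_inj g x y : act g x = act g y -> x = y.
Proof. by move=> xy; rewrite -(actK g x) xy actK. Qed.

Lemma dist_act g x y : d (act g x) (act g y) = d x y.
Proof.
suff le h a b : (d (act h a) (act h b) <= d a b)%N.
  by apply/eqP; rewrite eqn_leq le -{1}(actK g x) -{1}(actK g y) le.
by apply: dist_morphism => {}a {}b; rewrite act_edge.
Qed.

Lemma entrance_act g v x u : ent v x u -> ent (act g v) (act g x) (act g u).
Proof. by rewrite /entrance act_edge !dist_act. Qed.

Lemma stab_subgroup v : is_subgroup (stab v).
Proof.
apply/subgroupE; split=> [|x xv|x y xv yv]; rewrite /vertex_stabilizer /=.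
- exact: act1.
- by rewrite -{1}xv actK.
- by rewrite actM yv.
Qed.

Lemma stab_act g v : stab (act g v) = conj_set g (stab v).
Proof.
apply/seteqP; split=> [h hgv|_ [h hv <-]].
  exists (g^-1 * h * g); last by rewrite !mulgA mulgV mul1g mulgK.
  by rewrite /vertex_stabilizer /= !actM [act h _]hgv actK.
by rewrite /vertex_stabilizer /= !actM actK hv.
Qed.

Lemma conj_set_finite g (Q : set G) : finite_set (conj_set g Q) <-> finite_set Q.
Proof.
split; last exact: finite_image.
move=> /(finite_image (fun x => g^-1 * x * g)); apply: sub_finite_set => x Qx.
exists (g * x * g^-1); first by exists x.
by rewrite -!mulgA mulVg mulg1 mulKg.
Qed.

(** These elements form at most one coset of a subgroup that fixes the edge. *)
Lemma edge_movers_finite a b x v : e x v ->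
  finite_set [set g | act g a = x /\ act g b = v].
Proof.
move=> xv; have [[g0 [g0a g0b]]|none] :=
    pselect (exists g, act g a = x /\ act g b = v); last first.
  by apply: (@sub_finite_set _ _ set0) => // g gab; case: none; exists g.
apply: (@sub_finite_set _ _ [set k * g0 | k in edge_stabilizer act x v]).
  move=> g [ga gb]; exists (g * g0^-1); last by rewrite mulgVK.
  by left; rewrite !actM -{1}g0a -{1}g0b !actK.
by apply: finite_image; apply: edge_stab_finite.
Qed.

(** ** Turns *)

Fixpoint triples (x : V) (p : seq V) : seq (V * V * V) :=
  if p is y :: q then
    (if q is z :: _ then [:: (x, y, z)] else [::]) ++ triples y q
  else [::].

Variable turns : set (V * V * V).
Hypothesis turns_finite : finite_set turns.

(** Closed under translation and reversal, so that detours are equivariant and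
    symmetric. *)
Definition turn v x y := exists g t, turns t /\
  ((act g t.1.1 = x /\ act g t.2 = y) \/ (act g t.1.1 = y /\ act g t.2 = x))
  /\ act g t.1.2 = v.

Local Notation det := (detour e turn).

Lemma turn_sym v x y : turn v x y -> turn v y x.
Proof. by move=> [g [t [tt [xy gv]]]]; exists g, t; split=> //; split=> //; rewrite or_comm. Qed.

Lemma turn_act g v x y : turn v x y -> turn (act g v) (act g x) (act g y).
Proof.
move=> [h [t [tt [xy hv]]]]; exists (g * h), t; rewrite !actM hv; split=> //.
by split=> //; case: xy => [[-> ->]|[-> ->]]; [left|right].
Qed.

Lemma turn_finite v x : e x v -> finite_set [set y | e v y /\ turn v x y].
Proof.
move=> xv; apply: (@sub_finite_set _ _ (\bigcup_(t in turns)
  ([set act g t.2 | g in [set g | act g t.1.1 = x /\ act g t.1.2 = v]] `|`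
   [set act g t.1.1 | g in [set g | act g t.2 = x /\ act g t.1.2 = v]]))).
  by move=> y [vy [g [t [tt [[[gx gy]|[gy gx]] gv]]]]]; exists t => //;
    [left|right]; exists g.
apply: bigcup_finite => // t _; rewrite finite_setU.
by split; apply: finite_image; apply: edge_movers_finite.
Qed.

Lemma detour_act g v n x y : det v n x y -> det (act g v) n (act g x) (act g y).
Proof.
elim=> [m a av|m a b c [av bv ab] _ IH]; first by apply: detour0 => /act_inj.
apply: detourS IH; split; try by move=> /act_inj.
rewrite act_edge; case: ab => [|[av' vb avb]]; first by left.
by right; rewrite !act_edge; split=> //; apply: turn_act.
Qed.

Lemma detour_path g v x p : path e x p -> {subset triples x p <= turns} ->
  act g x <> v -> act g (last x p) <> v ->
  det v (size p) (act g x) (act g (last x p)).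
Proof.
have [n] := ubnP (size p); elim: n p x => // n IHn [|y p] x /=.
  by move=> _ _ _ xv _; apply: detour0.
move=> pn /andP[xy yp] tp xv pv.
have [yv|yv] := pselect (act g y = v); last first.
  apply: (@detourS _ _ _ _ _ _ (act g y)); last first.
    by apply: IHn => // t ty; apply: tp; rewrite mem_cat ty orbT.
  by split=> //; left; rewrite act_edge.
case: p pn yp tp pv => [//|z p] /= pn /andP[yz zp] tp pv.
apply: (@detour_mono _ _ _ _ (size p).+1) => //.
have zv : act g z <> v by rewrite -yv => /act_inj zy; move: yz; rewrite zy e_irr.
apply: (@detourS _ _ _ _ _ _ (act g z)); last first.
  apply: IHn => //; first by lia.
  by move=> t tz; apply: tp; rewrite in_cons mem_cat tz !orbT.
split=> //; right; rewrite -yv !act_edge; split=> //.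
exists g, (x, y, z); split; last by split=> //; left.
by have := tp (x, y, z) (mem_head _ _); rewrite inE.
Qed.

(** The link of [v] is locally finite and the stabilizer of [v] acts on it with
    finite stabilizers. *)
Lemma link_movers_finite v n b b' : e b v -> e b' v ->
  finite_set [set q | stab v q /\ det v n b (act q b')].
Proof.
move=> bv b'v.
have finL := link_finite e_sym e_fine turn_finite n bv.
apply: (@sub_finite_set _ _ (\bigcup_(u in [set u | e u v /\ det v n b u])
    [set q | act q b' = u /\ act q v = v])).
  move=> q [qv bq]; exists (act q b') => //; split=> //.
  by rewrite -qv act_edge.
by apply: bigcup_finite => // u [uv _]; apply: edge_movers_finite.
Qed.

(** ** Geodesics of the relative Cayley graph *)

(** The base point [w] has a finite stabilizer, so its orbit contains no vertex
    with infinite stabilizer; such vertices are the translates of the [vp P]. *)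
Variables (PP : set (set G)) (vp : set G -> V) (w : V).
Hypothesis PP_finite : finite_set PP.
Hypothesis stab_vp : forall P, PP P -> stab (vp P) = P.
Hypothesis PP_infinite : forall P, PP P -> infinite_set P.
Hypothesis PP_conj : forall P Q g, PP P -> PP Q -> P = conj_set g Q -> P = Q.
Hypothesis stab_PP : forall v, infinite_set (stab v) ->
  exists P g, PP P /\ stab v = conj_set g P.
Hypothesis stab_w : finite_set (stab w).

(** [A] is meant to contain all the finite sets of generators; fixed paths from
    [w] to [act s w], for [s] in [A], and to [vp P] are made of allowed turns. *)
Variables (A : set G) (M : nat).
Hypothesis path_A : forall s, A s -> exists p,
  [/\ edge_path e w (act s w) p, {subset triples w p <= turns} & (size p <= M)%N].
Hypothesis path_PP : forall P, PP P -> exists p,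
  [/\ edge_path e w (vp P) p, {subset triples w p <= turns} & (size p <= M)%N].

Variable X : set G.
Hypothesis X_sub : forall s, X s -> A s \/ exists2 P, PP P & P s.
Hypothesis PP_X : forall P s, PP P -> P s -> s <> 1 -> X s.
Hypothesis cayley_conn : connected_graph (cayley X).

Local Notation dX := (dist cayley_conn).

Definition cone v := infinite_set (stab v).

Lemma cone_vp g P : PP P -> cone (act g (vp P)).
Proof. by move=> PP_P; rewrite /cone stab_act conj_set_finite stab_vp //; apply: PP_infinite. Qed.

Lemma cone_neq v g : cone v -> act g w <> v.
Proof. by move=> + gv; apply; rewrite -gv stab_act conj_set_finite. Qed.

Lemma dist_orbit_A g s : A s -> (d (act g w) (act (g * s) w) <= M)%N.
Proof.
move=> /path_A[p [ps _ pM]]; rewrite actM dist_act; apply: leq_trans pM.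
exact: dist_le_size.
Qed.

Lemma dist_orbit_vp g P : PP P -> (d (act g w) (act g (vp P)) <= M)%N.
Proof.
move=> /path_PP[p [ps _ pM]]; rewrite dist_act; apply: leq_trans pM.
exact: dist_le_size.
Qed.

Lemma act_stab g P s : PP P -> P s -> act (g * s) (vp P) = act g (vp P).
Proof. by move=> PP_P Ps; rewrite actM; congr (act g _); rewrite -(stab_vp PP_P) in Ps. Qed.

Lemma dist_orbit_PP g P s : PP P -> P s -> (d (act g w) (act (g * s) w) <= M + M)%N.
Proof.
move=> PP_P Ps; apply: leq_trans (dist_triangle _ (act g (vp P)) _ _) _.
apply: leq_add; first exact: dist_orbit_vp.
by rewrite -(act_stab g PP_P Ps) (dist_sym e_sym) dist_orbit_vp.
Qed.

Lemma detour_A v g s : cone v -> A s -> det v M (act g w) (act (g * s) w).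
Proof.
move=> cv /path_A[p [[wp ps] tp pM]]; apply: detour_mono pM _.
by rewrite actM -ps; apply: detour_path => //; rewrite ?ps -?actM; apply: cone_neq.
Qed.

Lemma detour_vp v g P : cone v -> PP P -> act g (vp P) <> v ->
  det v M (act g w) (act g (vp P)).
Proof.
move=> cv /path_PP[p [[wp ps] tp pM]] gv; apply: detour_mono pM _.
by rewrite -ps; apply: detour_path => //; rewrite ?ps //; apply: cone_neq.
Qed.

Lemma detour_PP v g P s : cone v -> PP P -> P s -> act g (vp P) <> v ->
  det v (M + M) (act g w) (act (g * s) w).
Proof.
move=> cv PP_P Ps gv; apply: detour_trans (detour_vp cv PP_P gv) _.
rewrite -(act_stab g PP_P Ps); apply: (detour_sym e_sym turn_sym).
by apply: detour_vp => //; rewrite (act_stab g PP_P Ps).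
Qed.

Lemma distX_mul g x y : dX (g * x) (g * y) = dX x y.
Proof.
suff le (h a b : G) : (dX (h * a)%g (h * b)%g <= dX a b)%N.
  by apply/eqP; rewrite eqn_leq le -{1}(mulKg g x) -{1}(mulKg g y) le.
apply: (@dist_morphism _ _ _ (fun x => h * x)) => {}a {}b.
by rewrite /cayley invgM -mulgA mulKg.
Qed.

Lemma distX_PP P s : PP P -> P s -> (dX 1%g s <= 1)%N.
Proof.
move=> PP_P Ps; have [->|s1] := pselect (s = 1); first by rewrite distxx.
by apply: dist_edge; rewrite /cayley invg1 mul1g inE; apply: PP_X Ps s1.
Qed.

(** The elements that carry [b] to [a] form a coset of the stabilizer of [b], which
    is finite or, being peripheral, of diameter at most [1] up to conjugation. *)
Lemma transporter_short (vs : seq V) : exists C, forall a b g,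
  a \in vs -> b \in vs -> act g b = a -> (dX 1%g g <= C)%N.
Proof.
have [|||C CP] := @finite_bound _ [set` [seq (a, b) | a <- vs, b <- vs]]
  (fun n ab => forall g, act g ab.2 = ab.1 -> (dX 1%g g <= n)%N).
- exact: finite_seq.
- by move=> m n ab mn mP g /mP; move/leq_trans; apply.
- move=> [a b] _ /=; have [[g0 g0b]|none] := pselect (exists g, act g b = a); last first.
    by exists 0%N => g gb; case: none; exists g.
  have stabE g : act g b = a -> stab b (g0^-1 * g).
    by move=> gb; rewrite /vertex_stabilizer /= actM gb -g0b actK.
  have tri g : (dX 1%g g <= dX 1%g g0 + dX 1%g (g0^-1 * g)%g)%N.
    have := dist_triangle cayley_conn g0 1 g.
    by rewrite -(distX_mul g0^-1 g0 g) mulVg.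
  have [finb|infb] := pselect (finite_set (stab b)).
    have [||n nP] := finite_bound (P := fun n q => (dX 1%g q <= n)%N) finb.
    - by move=> m n q mn mP; apply: leq_trans mn.
    - by move=> q _; exists (dX 1 q).
    exists (dX 1%g g0 + n)%N => g gb; apply: leq_trans (tri g) _.
    by rewrite leq_add2l; apply: nP; apply: stabE.
  have [P [h [PP_P bE]]] := stab_PP infb.
  exists (dX 1%g g0 + (dX 1%g h + (1 + dX 1%g (h^-1)%g)))%N => g /stabE; rewrite bE => -[p Pp pE].
  apply: leq_trans (tri g) _; rewrite leq_add2l -pE -mulgA.
  apply: leq_trans (dist_triangle _ h _ _) _; rewrite leq_add2l.
  rewrite -{1}(mulg1 h) distX_mul; apply: leq_trans (dist_triangle _ p _ _) _.
  by rewrite leq_add ?(distX_PP PP_P) // -{1}(mulg1 p) distX_mul.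
- exists C => a b g avs bvs gb; apply: (CP (a, b)) => //=.
  by apply/allpairsP; exists (a, b).
Qed.

(** A path of the graph from [act g w] to [act g' w] is followed in the group up
    to bounded errors, because vertex stabilizers are finite or peripheral. *)
Lemma distX_le_orbit : exists C, forall g g',
  (dX g g' <= C * d (act g w) (act g' w) + C)%N.
Proof.
have [E EP] := edge_orbits; pose vs := w :: [seq ab.1 | ab <- E] ++ [seq ab.2 | ab <- E].
have [C CP] := transporter_short vs.
have CP' a b g h : a \in vs -> b \in vs -> act g a = act h b -> (dX g h <= C)%N.
  move=> avs bvs gh; rewrite -(distX_mul g^-1) mulVg; apply: (CP a b) => //.
  by rewrite actM -gh actK.
have follow p g a g' b : a \in vs -> b \in vs -> path e (act g a) p ->
    last (act g a) p = act g' b -> (dX g g' <= C * (size p).+1)%N.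
  move=> + bvs; elim: p g a => [|y p IHp] g a avs /=.
    by move=> _ gg'; rewrite muln1; apply: CP' gg'.
  move=> /andP[/EP[h [a' [b' [abE [ha' hb']]]]] yp] yg'.
  have a'vs : a' \in vs.
    by rewrite in_cons mem_cat (map_f fst abE : a' \in _) orbT.
  have b'vs : b' \in vs.
    by rewrite in_cons mem_cat (map_f snd abE : b' \in _) !orbT.
  apply: leq_trans (dist_triangle _ h _ _) _; rewrite mulnS leq_add //.
    by apply: CP' avs a'vs _.
  by apply: (IHp h b' b'vs); rewrite hb'.
exists C => g g'; have [p [gp pg'] <-] := geodesic_path e_conn (act g w) (act g' w).
by rewrite addnC -mulnS; apply: follow gp pg'; rewrite mem_head.
Qed.

(** Geodesics are functions of the index, so that subpaths are shifts. *)
Definition geodesicX (c : nat -> G) k :=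
  forall i j, (i <= j)%N -> (j <= k)%N -> dX (c i) (c j) = (j - i)%N.

Lemma geodesicX_shift c k i j : geodesicX c k -> (i + j <= k)%N ->
  geodesicX (fun t => c (i + t)%N) j.
Proof. by move=> gc ijk a b ab bj; rewrite gc ?subnDl //; lia. Qed.

Lemma geodesicX_step c k i : geodesicX c k -> (i < k)%N ->
  X ((c i)^-1 * c i.+1).
Proof.
move=> gc ik; have : cayley X (c i) (c i.+1).
  by apply: dist1_edge; rewrite gc //; lia.
by rewrite /cayley inE.
Qed.

(** Both ends of the [i]-th edge of [c] lie in the peripheral coset of which [v]
    is the cone vertex. *)
Definition through v (c : nat -> G) i :=
  exists P, [/\ PP P, P ((c i)^-1 * c i.+1) & act (c i) (vp P) = v].

Lemma geodesicX_quasi : exists C, (2 * M <= C)%N /\ forall c k,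
  geodesicX c k -> quasigeodesic e_conn C (fun t => act (c t) w) k.
Proof.
have [C CP] := distX_le_orbit; exists (C + 2 * M)%N; split; first by lia.
move=> c k gc; split=> [t tk|i j ij jk].
  have := geodesicX_step gc tk; set s := _ * _ => Xs.
  have -> : c t.+1 = c t * s by rewrite mulVKg.
  have [As|[P PP_P Ps]] := X_sub Xs.
    by apply: leq_trans (dist_orbit_A _ As) _; lia.
  by apply: leq_trans (dist_orbit_PP _ PP_P Ps) _; lia.
by rewrite -(gc i j ij jk); apply: leq_trans (CP _ _) _; rewrite leq_add ?leq_mul ?leq_addr.
Qed.

Lemma step_detour c k i v : geodesicX c k -> (i < k)%N -> cone v ->
  ~ through v c i -> det v (M + M) (act (c i) w) (act (c i.+1) w).
Proof.
move=> gc ik cv nvi; have := geodesicX_step gc ik; set s := _ * _ => Xs.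
have -> : c i.+1 = c i * s by rewrite mulVKg.
have [As|[P PP_P Ps]] := X_sub Xs.
  by apply: detour_mono (leq_addr _ _) _; apply: detour_A.
by apply: (detour_PP cv PP_P Ps) => civ; apply: nvi; exists P.
Qed.

(** A geodesic of the Cayley graph has at most one edge in each peripheral
    coset, since two points of such a coset are adjacent. *)
Lemma through_unique c k i j v : geodesicX c k -> (i < j)%N -> (j < k)%N ->
  through v c i -> through v c j -> False.
Proof.
move=> gc ij jk [P [PP_P Pi iv]] [Q [PP_Q Qj jv]].
have PQ : P = Q.
  apply: (@PP_conj _ _ ((c i)^-1 * c j)) => //.
  rewrite -(stab_vp PP_P) -(stab_vp PP_Q) -stab_act actM jv -iv actK.
  by rewrite stab_vp.
have Pij : P ((c i)^-1 * c j.+1).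
  rewrite -(stab_vp PP_P) /vertex_stabilizer /= actM.
  have <- : c j * ((c j)^-1 * c j.+1) = c j.+1 by rewrite mulVKg.
  by rewrite PQ (act_stab _ PP_Q Qj) jv -iv PQ actK.
have := distX_PP PP_P Pij; rewrite -(distX_mul (c i)) mulg1 mulVKg gc; lia.
Qed.

(** ** Bounded coset penetration *)

(** Instances of the projection lemmas with a common constant: for geodesics of
    the Cayley graph, for the jumps made by a letter or towards a cone vertex, for
    two entrances of the same point, and for geodesics of the graph. *)
Lemma bounded_penetration : exists N,
  [/\ forall c k v u u', geodesicX c k -> cone v ->
        (forall i, (i < k)%N -> ~ through v c i) ->
        ent v (act (c 0) w) u -> ent v (act (c k) w) u' -> det v N u u',
      forall g s v u u', cone v -> A s ->
        ent v (act g w) u -> ent v (act (g * s) w) u' -> det v N u u',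
      forall g P v u u', cone v -> PP P -> act g (vp P) <> v ->
        ent v (act g w) u -> ent v (act g (vp P)) u' -> det v N u u',
      forall x v u u', ent v x u -> ent v x u' -> det v N u u'
    & forall x y v u u', ent v x u -> ent v y u' -> between x v y \/ det v N u u'].
Proof.
have [C [MC CP]] := geodesicX_quasi.
have [N1 N1P] := entrance_quasigeodesic e_sym slim turn_sym C.+1.
have [N2 N2P] := entrance_btw_or_detour e_sym slim turn_sym.
have le1 : (N1 <= N1 + N2)%N by rewrite leq_addr.
have le2 : (N2 <= N1 + N2)%N by rewrite leq_addl.
have jump v x y u u' : (d x y <= M)%N -> det v M x y ->
    ent v x u -> ent v y u' -> det v N1 u u'.
  move=> xy dxy xu yu'; pose c t := if t is 0 then x else y.
  apply: (N1P v c 1%N u u' _ _ xu yu').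
    split=> [[|//] _ /=|]; first by lia.
    by move=> i j; lia.
  by move=> [|//] _ /=; apply: detour_mono dxy; lia.
exists (N1 + N2)%N; split.
- move=> c k v u u' gc cv nvc cu cu'; apply: detour_mono le1 _.
  apply: (N1P v (fun t => act (c t) w) k) => //.
    by apply: quasigeodesic_mono (CP c k gc); lia.
  by move=> t tk; apply: detour_mono (step_detour gc tk cv (nvc t tk)); lia.
- move=> g s v u u' cv As gu gu'; apply: detour_mono le1 _.
  by apply: jump gu gu'; [apply: dist_orbit_A|apply: detour_A].
- move=> g P v u u' cv PP_P gv gu gu'; apply: detour_mono le1 _.
  by apply: jump gu gu'; [apply: dist_orbit_vp|apply: detour_vp].
- move=> x v u u' xu xu'; apply: detour_mono le1 _.
  apply: (N1P v (fun=> x) 0%N) => //; split=> // i j; lia.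
- move=> x y v u u' xu yu'; have [|xy] := N2P v x y u u' xu yu'; first by left.
  by right; apply: detour_mono xy.
Qed.

(** ** Chains in the link of a vertex *)

(** The number of steps of a chain in the link of a cone vertex plays the role of
    a word length in the peripheral subgroup, see [chain_word]. *)
Inductive chain (K : set V) v n : nat -> V -> V -> Prop :=
| chain0 m u : chain K v n m u u
| chainS m u u' u'' :
    K u' -> det v n u u' -> chain K v n m u' u'' -> chain K v n m.+1 u u''.

Lemma chain_mono K K' v n n' m m' u u' : K `<=` K' -> (n <= n')%N -> (m <= m')%N ->
  chain K v n m u u' -> chain K' v n' m' u u'.
Proof.
move=> KK' nn' + uu'; elim: uu' m' => [k x|k x y z /KK' Ky xy _ IH] m' km'.
  exact: chain0.
case: m' km' => // m' km'; apply: chainS (IH _ km') => //.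
exact: detour_mono xy.
Qed.

Lemma chain_trans K v n m m' x y z :
  chain K v n m x y -> chain K v n m' y z -> chain K v n (m + m') x z.
Proof.
elim=> [k u|k u u' u'' Ku' uu' _ IH] xz; last exact: chainS uu' (IH xz).
by apply: chain_mono xz => //; apply: leq_addl.
Qed.

Lemma chain1 K v n u u' : K u' -> det v n u u' -> chain K v n 1 u u'.
Proof. by move=> Ku' uu'; apply: chainS uu' _ => //; apply: chain0. Qed.

Lemma chain_act g K K' v n m u u' : (forall x, K x -> K' (act g x)) ->
  chain K v n m u u' -> chain K' (act g v) n m (act g u) (act g u').
Proof.
move=> Kg; elim=> [k x|k x y z Ky xy _ IH]; first exact: chain0.
by apply: chainS IH; [apply: Kg|apply: detour_act].
Qed.

Definition link v : set V := [set u | e u v].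

(** The vertices of a chain being translates of finitely many neighbours of [v]
    by elements of a subgroup of the stabilizer, consecutive translating
    elements differ by one of finitely many elements. *)
Lemma chain_word (Q Y : set G) v (D : set V) n :
  is_subgroup Q -> gen Y = Q -> Q `<=` stab v ->
  finite_set D -> (forall b, D b -> e b v) ->
  exists C, forall m u u' q q' b b',
    chain [set act p x | p in Q & x in D] v n m u u' ->
    Q q -> D b -> u = act q b -> Q q' -> D b' -> u' = act q' b' ->
  word Y (C * m.+1) (q^-1 * q').
Proof.
move=> sQ YQ Qv finD Dv; have [Q1 QV QM] := (subgroupE Q).1 sQ.
pose F := [set q | Q q /\ exists b b', [/\ D b, D b' & det v n b (act q b')]].
have finF : finite_set F.
  apply: (@sub_finite_set _ _ (\bigcup_(b in D) \bigcup_(b' in D)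
      [set q | stab v q /\ det v n b (act q b')])).
    by move=> q [/Qv qv [b [b' [Db Db' bb']]]]; exists b => //; exists b'.
  apply: bigcup_finite => // b /Dv bv; apply: bigcup_finite => // b' /Dv b'v.
  exact: link_movers_finite.
have [C CP] : exists C, forall q, F q -> word Y C q.
  by apply: word_bound finF _ => q [Qq _]; rewrite YQ.
have FP q q' b b' : Q q -> Q q' -> D b -> D b' ->
    det v n (act q b) (act q' b') -> word Y C (q^-1 * q').
  move=> Qq Qq' Db Db' bb'; apply: CP; split; first by apply: QM => //; apply: QV.
  exists b, b'; split=> //; have /Qv qv : Q q^-1 by apply: QV.
  by rewrite actM -{1}(actK q b) -[v in det v]qv; apply: detour_act.
exists C => m u u' q q' b b' uu'; elim: uu' q b => {m u u'} [m u|m u x u' [p Qp [y Dy pyx]] ux _ IH] q b Qq Db uE Qq' Db' u'E.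
  apply: (@word_mono _ _ C); first by rewrite leq_pmulr.
  apply: (FP q q' b b') => //; rewrite -uE -u'E; apply: detour0 => uv.
  by have /Qv qv := Qq; move: (Dv b Db); rewrite -(act_edge q) -uE qv uv e_irr.
rewrite -[q^-1 * q'](divgKA p^-1) invgK mulnS; apply: wordM.
  by apply: (FP q p b y) => //; rewrite -uE pyx.
exact: (IH p y).
Qed.

(** ** Relatively quasiconvex subgroups *)

Variable H : set G.
Hypothesis sH : is_subgroup H.
Variable Bq : set G.
Hypothesis Bq_finite : finite_set Bq.
Hypothesis H_quasiconvex : forall x y v, H x -> H y -> btw cayley_conn x v y ->
  exists h b, [/\ H h, Bq b & v = h * b].

Variables (S T : set G).
Hypothesis SA : S `<=` A.
Hypothesis TA : T `<=` A.
Hypothesis TH : gen T = H.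

Hypothesis A_finite : finite_set A.
Hypothesis S_finite : finite_set S.
Hypothesis SG : gen S = [set: G].
Hypothesis T_finite : finite_set T.

Variables (OO : set (set G)) (gO : set G -> G) (PO SO TO : set G -> set G).
Hypothesis OO_induced : induced_peripheral_structure PP H OO.
Hypothesis OO_data : forall O, OO O ->
  [/\ PP (PO O), O = H `&` conj_set (gO O) (PO O),
      finite_generating_set (SO O) (conj_set (gO O) (PO O))
    & finite_generating_set (TO O) O].

Local Notation distO O := (distortion (SO O) O (TO O)).
Local Notation f := (fun n => max_nat [set distO O n | O in OO]).

Section Penetration.

Variable N : nat.
Hypothesis penetration_geodesic : forall c k v u u', geodesicX c k -> cone v ->
  (forall i, (i < k)%N -> ~ through v c i) ->
  ent v (act (c 0) w) u -> ent v (act (c k) w) u' -> det v N u u'.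
Hypothesis penetration_A : forall g s v u u', cone v -> A s ->
  ent v (act g w) u -> ent v (act (g * s) w) u' -> det v N u u'.
Hypothesis penetration_vp : forall g P v u u',
  cone v -> PP P -> act g (vp P) <> v ->
  ent v (act g w) u -> ent v (act g (vp P)) u' -> det v N u u'.
Hypothesis entrance_close : forall x v u u',
  ent v x u -> ent v x u' -> det v N u u'.
Hypothesis btw_or_close : forall x y v u u',
  ent v x u -> ent v y u' -> between x v y \/ det v N u u'.

Lemma geodesicX_ex x y : exists c, [/\ c 0 = x, c (dX x y) = y,
  geodesicX c (dX x y) & forall i, (i <= dX x y)%N -> btw cayley_conn x (c i) y].
Proof.
have [c [c0 ck cb cd]] := geodesic_parametrization cayley_conn x y.
by exists c; split.
Qed.

Lemma geodesicX_from c k i : geodesicX c k -> (i < k)%N ->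
  geodesicX (fun t => c (i.+1 + t)%N) (k - i.+1).
Proof. by move=> gc ik; apply: geodesicX_shift gc _; lia. Qed.

(** Otherwise a geodesic of the Cayley graph from [1] to [h] would go around [v].
    Hence one of its edges lies in the coset of [v]; the end [h' * b] of this edge
    is close to [H], and the rest of the geodesic goes around [v]. *)
Lemma far_entrance_near_subgroup v h u u' : cone v -> H h ->
    ent v w u -> ent v (act h w) u' -> ~ det v N u u' ->
  exists h' b P, [/\ H h', Bq b, PP P, act (h' * b) (vp P) = v
    & forall z, ent v (act (h' * b) w) z -> det v N z u'].
Proof.
move=> cv Hh wu hu' far; have [H1 _ _] := (subgroupE H).1 sH.
have [c [c0 ck gc cb]] := geodesicX_ex 1 h; set k := dX 1 h in ck gc cb.
have [i ik ci] : exists2 i, (i < k)%N & through v c i.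
  apply: contrapT => nc; apply: far.
  apply: (penetration_geodesic gc cv) => [i ik ci||]; rewrite ?c0 ?ck ?act1 //.
  by apply: nc; exists i.
have [P [PP_P Ps civ]] := ci.
have [h' [b [Hh' Bb cE]]] := H_quasiconvex H1 Hh (cb i.+1 ik).
have civ' : act (c i.+1) (vp P) = v.
  by rewrite -(mulVKg (c i) (c i.+1)) act_stab.
exists h', b, P; rewrite -cE; split=> // z cz.
apply: (penetration_geodesic (geodesicX_from gc ik) cv).
- move=> j jk cj; apply: (@through_unique c k i (i.+1 + j) v) => //; try lia.
  by have [P' [? + ?]] := cj; rewrite addnS => P's; exists P'.
- by rewrite addn0.
- by rewrite subnKC // ck.
Qed.

(** Only finitely many elements of the stabilizer of [v] keep an entrance close to
    itself, so an infinite intersection contains one that moves it far. *)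
Lemma infinite_intersection_near v : cone v -> infinite_set (H `&` stab v) ->
  exists h b P, [/\ H h, Bq b, PP P & act (h * b) (vp P) = v].
Proof.
move=> cv infO; have wv : w <> v by rewrite -(act1 w); apply: cone_neq.
have [u wu] := entrance_ex e_conn wv; have uv : e u v by case: wu.
have [q [[Hq qv] far]] : exists q, (H `&` stab v) q /\ ~ det v N u (act q u).
  apply: contrapT => none; apply: infO.
  apply: sub_finite_set (link_movers_finite N uv uv) => q [Hq qv].
  by split=> //; apply: contrapT => far; apply: none; exists q.
have qu : ent v (act q w) (act q u) by rewrite -[v in ent v]qv; apply: entrance_act.
have [h [b [P [Hh Bb PP_P hv _]]]] := far_entrance_near_subgroup cv Hq wu qu far.
by exists h, b, P.
Qed.

(** An element that fixes [x] and [y] permutes the entrances of [y] at [x], which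
    are close to each other. *)
Lemma stab_inter_finite x y : x <> y -> finite_set (stab x `&` stab y).
Proof.
move=> xy; have [u yu] : exists u, ent x y u by apply: entrance_ex => /esym.
have ux : e u x by case: yu.
apply: sub_finite_set (link_movers_finite N ux ux) => q [qx qy]; split=> //.
by apply: (entrance_close yu); have := entrance_act q yu; rewrite [act q x]qx [act q y]qy.
Qed.

Lemma entrance_choice v : cone v -> exists f : G -> V,
  forall g, ent v (act g w) (f g).
Proof.
move=> cv; have [f fP] : {f : G -> V & forall g, ent v (act g w) (f g)}.
  by apply: (@choice _ _ (fun g u => ent v (act g w) u)) => g; apply: entrance_ex; apply: cone_neq.
by exists f.
Qed.

Lemma penetration_word (W : set G) v a t u u' : W `<=` A -> cone v ->
    W ((a t)^-1 * a t.+1) \/ W ((a t.+1)^-1 * a t) ->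
  ent v (act (a t) w) u -> ent v (act (a t.+1) w) u' -> det v N u u'.
Proof.
move=> WA cv [/WA As|/WA As] au au'.
  by apply: (penetration_A cv As au); rewrite mulVKg.
by apply: (detour_sym e_sym turn_sym); apply: (penetration_A cv As au'); rewrite mulVKg.
Qed.

(** Projecting a word of [H] to the link of [v] gives a chain.  A term far from the
    first one is close, by [far_entrance_near_subgroup], to an entrance of some
    [h' * b]; two such [h'] with the same [b] and [P] differ by an element of [H]
    that stabilizes [v].  So all terms are translates of finitely many neighbours
    and [chain_word] applies. *)
Lemma peripheral_undistorted v Y : cone v -> gen Y = H `&` stab v ->
  exists C, forall n o, H o -> stab v o -> word T n o -> word Y (C * n + C) o.
Proof.
move=> cv YO; set O := H `&` stab v in YO.
have [H1 HV HM] := (subgroupE H).1 sH.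
have [f fP] := entrance_choice cv.
have f1 : ent v w (f 1) by rewrite -{1}(act1 w).
have fv g : e (f g) v by case: (fP g).
pose ball u : set V := [set u' | e u' v /\ det v N u u'].
have finball u : e u v -> finite_set (ball u).
  by move=> uv; apply: (link_finite e_sym e_fine turn_finite).
pose covers (bP : G * set G) (D : set V) := forall h u, H h ->
  act (h * bP.1) (vp bP.2) = v -> e u v ->
  (forall z, ent v (act (h * bP.1) w) z -> det v N z u) ->
  [set act q x | q in O & x in D] u.
have [Df DfP] : {Df : G * set G -> set V & forall bP,
    [/\ finite_set (Df bP), Df bP `<=` link v & covers bP (Df bP)]}.
  apply: (@choice _ _ (fun bP D => [/\ finite_set D, D `<=` link v & covers bP D])) => -[b P].
  have [[k Hk kv]|none] := pselect (exists2 k, H k & act (k * b) (vp P) = v); last first.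
    exists set0; split=> // h u Hh hv; by case: none; exists h.
  exists (ball (f (k * b))); split; [exact: finball|by move=> u []|].
  move=> h u Hh /= hv uv hu; have qv : act (h * k^-1) v = v.
    by rewrite -{1}kv -actM mulgA mulgVK.
  have qV : act (h * k^-1)^-1 v = v by rewrite -{1}qv actK.
  exists (h * k^-1); first by split=> //; apply: HM => //; apply: HV.
  exists (act (h * k^-1)^-1 u); last exact: actVK.
  split; first by rewrite -{1}qV act_edge.
  have /(entrance_act (h * k^-1)) := fP (k * b).
  rewrite qv -actM mulgA mulgVK => /hu /(detour_act (h * k^-1)^-1).
  by rewrite qV actK.
pose D := ball (f 1) `|` \bigcup_(bP in Bq `*` PP) Df bP.
have finD : finite_set D.
  rewrite finite_setU; split; first exact: finball.
  by apply: bigcup_finite => [|bP _]; [apply: finite_setX|case: (DfP bP)].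
have Dv b : D b -> e b v.
  by case=> [[]//|[bP _]]; have [_ + _] := DfP bP; apply.
have sO : is_subgroup O by rewrite -YO; apply: gen_subgroup.
have [O1 OV OM] := (subgroupE O).1 sO.
have Ov : O `<=` stab v by move=> q [].
have cover h : H h -> [set act q x | q in O & x in D] (f h).
  move=> Hh; have [near|far] := pselect (det v N (f 1) (f h)).
    by exists 1 => //; exists (f h); [left; split|rewrite act1].
  have [h' [b [P [Hh' Bb PP_P hv hz]]]] :=
    far_entrance_near_subgroup cv Hh f1 (fP h) far.
  have [_ _ /(_ h' (f h) Hh' hv (fv h) hz)[q Oq [x Dx qx]]] := DfP (b, P).
  by exists q => //; exists x => //; right; exists (b, P).
have [C CP] := chain_word N sO YO Ov finD Dv.
exists C => n o Ho ov /word_path[m [a [mn a0 am aT aS]]].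
have Ha t : H (a t) by rewrite -TH.
have along i : (i <= m)%N -> chain [set act q x | q in O & x in D] v N i (f 1) (f (a i)).
  elim: i => [|i IHi] im; first by rewrite a0; apply: chain0.
  have step := penetration_word TA cv (aS i im) (fP (a i)) (fP (a i.+1)).
  have := chain_trans (IHi (ltnW im)) (chain1 (cover _ (Ha i.+1)) step).
  by rewrite addn1.
have Df1 : D (f 1) by left; split=> //; exact: (entrance_close f1 f1).
have oVv : act o^-1 v = v by rewrite -{1}[v]ov actK.
have Dfo : D (act o^-1 (f o)).
  left; split; first by rewrite -{1}oVv act_edge.
  by apply: (entrance_close f1); have := entrance_act o^-1 (fP o); rewrite oVv actK.
have := CP _ _ _ 1 o (f 1) (act o^-1 (f o)) (along m (leqnn m)).
rewrite invg1 mul1g act1 actVK am => /(_ O1 Df1 erefl (conj Ho ov) Dfo erefl).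
by apply: word_mono; rewrite mulnS addnC leq_add2r leq_mul2l mn orbT.
Qed.

(** ** Projections of a word path to the peripheral cosets of a geodesic *)

(** A boolean, since the terms with this property are counted. *)
Definition far_from_both n v u u' z := `[< ~ det v n u z /\ ~ det v n z u' >].

(** At a term near [u] the chain can be restarted from [u], and the first term near
    [u'] closes it; so only the terms that are far from both ends contribute. *)
Lemma chain_far_from_both v n u u' (f : nat -> V) m : (N <= n)%N ->
    e u v -> e u' v -> (forall j, e (f j) v) -> det v N u (f 0%N) ->
    det v N (f m) u' -> (forall j, (j < m)%N -> det v N (f j) (f j.+1)) ->
  chain (link v) v n (3 + \sum_(0 <= j < m.+1) far_from_both n v u u' (f j))%N u u'.
Proof.
move=> Nn uv u'v fv uf0 fmu' ff.
have close x y : det v N x y -> det v n x y by apply: detour_mono.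
have linkf j : link v (f j) by apply: fv.
suff [uc|//] : chain (link v) v n (1 + \sum_(0 <= j < m.+1) far_from_both n v u u' (f j))%N u (f m)
    \/ chain (link v) v n (3 + \sum_(0 <= j < m.+1) far_from_both n v u u' (f j))%N u u'.
  apply: chain_mono (chain_trans uc (chain1 (u'v : link v u') (close _ _ fmu'))) => //.
  by lia.
have : (m <= m)%N by [].
move: {-2}m; elim=> [|j IHj] jm.
  left; apply: chain_mono (chain1 (linkf _) (close _ _ uf0)) => //; exact: leq_addr.
rewrite big_nat_recr //=; set s := bigop.body _ _ _ in IHj *; set b := far_from_both _ _ _ _ _.
case: (IHj (ltnW jm)) => uc; last by right; apply: chain_mono uc => //; lia.
have step := chain_trans uc (chain1 (linkf _) (close _ _ (ff j jm))).
have [far|] := boolP b; first by left; apply: chain_mono step => //; rewrite far; lia.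
move=> /asboolPn/not_andP[/contrapT near|/contrapT near].
  by left; apply: chain_mono (chain1 (linkf _) near) => //; lia.
right; apply: chain_mono (chain_trans step (chain1 (u'v : link v u') near)) => //.
by rewrite -/s; lia.
Qed.

Lemma sum_at_most_one k (b : nat -> bool) :
  (forall i j, (i < j)%N -> (j < k)%N -> b i -> b j -> False) ->
  (\sum_(0 <= i < k) b i <= 1)%N.
Proof.
elim: k => [|k IHk] bk; first by rewrite big_geq.
rewrite big_nat_recr //=; case: (boolP (b k)) => bk1; last first.
  by rewrite addn0; apply: IHk => i j ij jk; apply: bk; lia.
rewrite big_nat_cond big1 // => i; rewrite andbT => ik; case: (boolP (b i)) => // bi.
by case: (bk i k).
Qed.

Section Behrstock.
Variables (h : G) (c : nat -> G) (k : nat).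
Hypotheses (gc : geodesicX c k) (c0 : c 0%N = 1) (ck : c k = h).

Lemma close4 v a1 a2 a3 a4 a5 : det v N a1 a2 -> det v N a2 a3 -> det v N a3 a4 ->
  det v N a4 a5 -> det v (4 * N) a1 a5.
Proof.
move=> d1 d2 d3 d4.
by have := detour_trans d1 (detour_trans d2 (detour_trans d3 d4)); apply: detour_mono; lia.
Qed.

Lemma close_sym v a b : det v N a b -> det v N b a.
Proof. exact: (detour_sym e_sym turn_sym). Qed.

Lemma close_before i v u u' j : (i < k)%N -> through v c i -> (j <= i)%N -> cone v ->
  ent v (act (c j) w) u -> ent v (act (c i) w) u' -> det v N u u'.
Proof.
move=> ik ci ji cv ju iu'.
have gc' : geodesicX (fun t => c (j + t)%N) (i - j) by apply: geodesicX_shift gc _; lia.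
apply: (penetration_geodesic gc' cv) _ => [t tij [P [PP_P Ps vE]]||].
- apply: (@through_unique c k (j + t)%N i v gc) => //; first by lia.
  by exists P; rewrite -addnS.
- by rewrite addn0.
- by rewrite subnKC.
Qed.

Lemma close_after i v u u' j : (i < k)%N -> through v c i -> (i < j <= k)%N -> cone v ->
  ent v (act (c i.+1) w) u -> ent v (act (c j) w) u' -> det v N u u'.
Proof.
move=> ik ci ij cv iu ju'.
have gc' : geodesicX (fun t => c (i.+1 + t)%N) (j - i.+1) by apply: geodesicX_shift gc _; lia.
apply: (penetration_geodesic gc' cv) _ => [t tij [P [PP_P Ps vE]]||].
- apply: (@through_unique c k i (i.+1 + t)%N v gc) => //; try by lia.
  by exists P; rewrite -addnS.
- by rewrite addn0.
- by rewrite subnKC //; lia.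
Qed.

(** Behrstock's inequality.  If [x] projects far from both ends on the cosets of
    [v] and [v'], then [v] and [v'] both lie between [1] and [x], and between [x]
    and [h].  Since [v] comes before [v'] on the way from [1] to [h], the former
    makes [x] closer to [v'] than to [v], and the latter closer to [v]. *)
Lemma at_most_one_far i j v v' u1 u2 u1' u2' x z z' : (i < j)%N -> (j < k)%N ->
    cone v -> cone v' -> through v c i -> through v' c j ->
    ent v (act (c i) w) u1 -> ent v (act (c i.+1) w) u2 ->
    ent v' (act (c j) w) u1' -> ent v' (act (c j.+1) w) u2' ->
    ~ det v (4 * N) u1 u2 -> ~ det v' (4 * N) u1' u2' ->
    ent v x z -> ent v' x z' ->
    far_from_both (2 * N) v u1 u2 z -> far_from_both (2 * N) v' u1' u2' z' ->
  False.
Proof.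
move=> ij jk cv cv' ci cj iu1 iu2 ju1 ju2 big big' xz xz' /asboolP[f1 f2] /asboolP[f1' f2'].
have ik : (i < k)%N by lia.
have vv' : v <> v' by move=> vv'; apply: (through_unique gc ij jk ci); rewrite vv'.
have [s ws] := entrance_ex e_conn (@cone_neq v 1 cv).
have [s' ws'] := entrance_ex e_conn (@cone_neq v' 1 cv').
have [t ht] := entrance_ex e_conn (@cone_neq v h cv).
have [t' ht'] := entrance_ex e_conn (@cone_neq v' h cv').
have su : det v N s u1 by apply: (close_before ik ci (leq0n i) cv) iu1; rewrite c0.
have su' : det v' N s' u1' by apply: (close_before jk cj (leq0n j) cv') ju1; rewrite c0.
have ut : det v N u2 t.
  by apply: (close_after ik ci _ cv iu2 (_ : ent v (act (c k) w) t)); rewrite ?ck //; lia.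
have ut' : det v' N u2' t'.
  by apply: (close_after jk cj _ cv' ju2 (_ : ent v' (act (c k) w) t')); rewrite ?ck //; lia.
have two y a1 a2 a3 : det y N a1 a2 -> det y N a2 a3 -> det y (2 * N) a1 a3.
  by move=> d1 d2; have := detour_trans d1 d2; apply: detour_mono; lia.
have bs : between (act 1 w) v x.
  have [//|sz] := btw_or_close ws xz.
  by case: f1; apply: two (close_sym su) sz.
have bs' : between (act 1 w) v' x.
  have [//|sz] := btw_or_close ws' xz'.
  by case: f1'; apply: two (close_sym su') sz.
have bt : between x v (act h w).
  have [//|zt] := btw_or_close xz ht.
  by case: f2; apply: two zt (close_sym ut).
have bt' : between x v' (act h w).
  have [//|zt] := btw_or_close xz' ht'.
  by case: f2'; apply: two zt (close_sym ut').
have bv : between (act 1 w) v v'.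
  have [P [PP_P Ps vE]] := cj.
  have [r v'r] := entrance_ex e_conn (nesym vv').
  have [//|sr] := btw_or_close ws v'r; case: big.
  have [q jq] := entrance_ex e_conn (@cone_neq v (c j) cv).
  have uq : det v N u2 q by apply: (close_after ik ci _ cv iu2 jq); lia.
  have qr : det v N q r.
    by apply: (@penetration_vp (c j) P) jq _ => //; rewrite vE //; apply: nesym.
  exact: close4 (close_sym su) sr (close_sym qr) (close_sym uq).
have bv' : between (act h w) v' v.
  have [P [PP_P Ps vE]] := ci.
  have vE' : act (c i.+1) (vp P) = v by rewrite -(mulVKg (c i) (c i.+1)) act_stab.
  have [r vr] := entrance_ex e_conn vv'.
  have [//|tr] := btw_or_close ht' vr; case: big'.
  have [q iq] := entrance_ex e_conn (@cone_neq v' (c i.+1) cv').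
  have qu : det v' N q u1' by apply: (close_before jk cj ij cv' iq).
  have qr : det v' N q r.
    by apply: (@penetration_vp (c i.+1) P) iq _ => //; rewrite vE'.
  exact: close4 (close_sym qu) qr (close_sym tr) (close_sym ut').
have vv'0 : d v v' <> 0%N by move=> /dist0_eq.
move: bs bs' bt bt' bv bv'; rewrite /btw.
rewrite (dist_sym e_sym e_conn v' v) (dist_sym e_sym e_conn (act h w) v').
rewrite (dist_sym e_sym e_conn (act h w) v) (dist_sym e_sym e_conn v x).
by rewrite (dist_sym e_sym e_conn v' x); lia.
Qed.

(** The chain at the [i]-th coset counts the vertices of a word path for [h] whose
    projection is far from both ends; each vertex is counted for at most one
    coset. *)
Lemma total_chain_length n : word S n h -> exists m : nat -> nat,
  (\sum_(0 <= i < k) m i <= 3 * k + n + 1)%N /\ forall i, (i < k)%N ->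
  (exists2 P, PP P & P ((c i)^-1 * c i.+1)) ->
  exists P u1 u2, let v := act (c i) (vp P) in
  [/\ PP P, P ((c i)^-1 * c i.+1), ent v (act (c i) w) u1, ent v (act (c i.+1) w) u2 &
      chain (link v) v (4 * N) (m i) u1 u2].
Proof.
move=> /word_path[l [a [ln a0 al _ aS]]].
pose good i (D : set G * V * V) := let: (P, u1, u2) := D in
  [/\ PP P, P ((c i)^-1 * c i.+1), ent (act (c i) (vp P)) (act (c i) w) u1
    & ent (act (c i) (vp P)) (act (c i.+1) w) u2].
have [D DP] : {D : nat -> set G * V * V & forall i,
    (exists2 P, PP P & P ((c i)^-1 * c i.+1)) -> good i (D i)}.
  apply: (@choice _ _ (fun i D => _ -> good i D)) => i.
  have [[P PP_P Ps]|none] := pselect (exists2 P, PP P & P ((c i)^-1 * c i.+1)); last first.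
    by exists (set0, w, w).
  have [u1 iu1] := entrance_ex e_conn (@cone_neq (act (c i) (vp P)) (c i) (cone_vp PP_P)).
  have [u2 iu2] := entrance_ex e_conn (@cone_neq (act (c i) (vp P)) (c i.+1) (cone_vp PP_P)).
  by exists (P, u1, u2).
pose v i := act (c i) (vp (D i).1.1).
have [f fP] : {f : nat * nat -> V & forall ij, cone (v ij.1) ->
    ent (v ij.1) (act (a ij.2) w) (f ij)}.
  apply: (@choice _ _ (fun ij u => cone (v ij.1) -> ent (v ij.1) (act (a ij.2) w) u)).
  move=> [i j] /=; have [cv|] := pselect (cone (v i)); last by exists w.
  by have [u iu] := entrance_ex e_conn (@cone_neq _ (a j) cv); exists u.
pose big i := `[< good i (D i) /\ ~ det (v i) (4 * N) (D i).1.2 (D i).2 >].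
pose own i j := big i && far_from_both (2 * N) (v i) (D i).1.2 (D i).2 (f (i, j)).
exists (fun i => 3 + \sum_(0 <= j < l.+1) own i j)%N; split.
  rewrite big_split /= sum_nat_const_nat subn0 mulnC -addnA leq_add2l.
  rewrite exchange_big_nat /= -[(n + 1)%N]mul1n.
  apply: (@leq_trans (\sum_(0 <= j < l.+1) 1)); last first.
    by rewrite sum_nat_const_nat; lia.
  apply: leq_sum => j _; apply: sum_at_most_one => i i' ii' i'k.
  move=> /andP[/asboolP[gi bi] fi] /andP[/asboolP[gi' bi'] fi'].
  have fi1 := fP (i, j); have fi1' := fP (i', j); move: gi gi' bi bi' fi fi' fi1 fi1'.
  rewrite /v; case: (D i) => [[P u1] u2]; case: (D i') => [[P' u1'] u2'] /=.
  move=> [PP_P Ps iu1 iu2] [PP_P' Ps' iu1' iu2'] bi bi' fi fi' fi1 fi1'.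
  apply: (@at_most_one_far i i' _ _ u1 u2 u1' u2' (act (a j) w) _ _ ii' i'k) fi fi' => //.
  - exact: cone_vp.
  - exact: cone_vp.
  - by exists P.
  - by exists P'.
  - by apply: fi1; apply: cone_vp.
  - by apply: fi1'; apply: cone_vp.
move=> i ik /DP; rewrite /own /big => gi; move: (gi) (fun j => fP (i, j)).
rewrite /v; move: gi; case: (D i) => [[P u1] u2] /= gi [PP_P Ps iu1 iu2] fi.
exists P, u1, u2; split=> //.
have cv : cone (act (c i) (vp P)) by apply: cone_vp.
have vi : through (act (c i) (vp P)) c i by exists P.
have u1v : e u1 (act (c i) (vp P)) by case: iu1.
have u2v : e u2 (act (c i) (vp P)) by case: iu2.
have [near|far] := pselect (det (act (c i) (vp P)) (4 * N) u1 u2).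
  by apply: chain_mono (chain1 (u2v : link (act (c i) (vp P)) u2) near) => //; lia.
have -> : `[< good i (P, u1, u2) /\ ~ det (act (c i) (vp P)) (4 * N) u1 u2 >] = true.
  exact/asboolP.
have N2 : (N <= 2 * N)%N by lia.
apply: chain_mono (chain_far_from_both (f := fun j => f (i, j)) (m := l) N2 u1v u2v _ _ _ _) => //.
- by lia.
- by move=> j; case: (fi j cv).
- apply: close_sym; apply: (@close_before i _ _ _ 0%N ik vi) => //.
  by have := fi 0%N cv; rewrite a0 c0.
- apply: close_sym; apply: (@close_after i _ _ _ k ik vi) iu2 _ => //; first by lia.
  by have := fi l cv; rewrite al ck.
- by move=> j jl; apply: penetration_word SA cv (aS j jl) (fi j cv) (fi j.+1 cv).
Qed.

End Behrstock.

(** ** Comparing the distortions *)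

Definition vO O := act (gO O) (vp (PO O)).

Lemma stab_vO O : OO O -> stab (vO O) = conj_set (gO O) (PO O).
Proof. by case/OO_data => PP_P _ _ _; rewrite /vO stab_act stab_vp. Qed.

Lemma OO_stab O : OO O -> O = H `&` stab (vO O).
Proof. by move=> OO_O; rewrite stab_vO //; case: (OO_data OO_O). Qed.

Lemma OO_in O o : OO O -> O o -> H o /\ stab (vO O) o.
Proof. by move=> OO_O; have := OO_stab OO_O => {1}->. Qed.

Lemma cone_vO O : OO O -> cone (vO O).
Proof. by case/OO_data => PP_P _ _ _; apply: cone_vp. Qed.

Lemma OO_infinite O : OO O -> infinite_set O.
Proof. by case: OO_induced => OOF _ /OOF[]. Qed.

Lemma OO_sub O : OO O -> O `<=` conj_set (gO O) (PO O).
Proof. by move=> OO_O o /(OO_in OO_O)[_]; rewrite stab_vO. Qed.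

Lemma conj_setM g h (Q : set G) : conj_set (g * h) Q = conj_set g (conj_set h Q).
Proof.
apply/seteqP; split=> [_ [x Qx <-]|_ [_ [x Qx <-] <-]].
  by exists (h * x * h^-1); [exists x|rewrite invgM !mulgA].
by exists x; rewrite // invgM !mulgA.
Qed.

Lemma conj_set1 (Q : set G) : conj_set 1 Q = Q.
Proof.
apply/seteqP; split=> [_ [x Qx <-]|x Qx]; first by rewrite invg1 mulg1 mul1g.
by exists x; rewrite // invg1 mulg1 mul1g.
Qed.

Lemma conj_set_subgroup h : H h -> conj_set h H = H.
Proof.
have [H1 HV HM] := (subgroupE H).1 sH => Hh.
apply/seteqP; split=> [_ [x Hx <-]|x Hx].
  by apply: (HM _ _ (HM _ _ Hh Hx)); apply: HV.
exists (h^-1 * x * h); last by rewrite !mulgA mulgV mul1g mulgK.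
by apply: (HM) => //; apply: HM => //; apply: HV.
Qed.

Lemma conj_setI g (Q Q' : set G) : conj_set g (Q `&` Q') = conj_set g Q `&` conj_set g Q'.
Proof.
apply/seteqP; split=> [_ [x [Qx Q'x] <-]|_ [[x Qx <-] [y Q'y]]].
  by split; exists x.
by move=> /mulIg/mulgI yx; exists x => //; split=> //; rewrite -yx.
Qed.

Lemma OO_conj_eq O O' h : OO O -> OO O' -> H h -> O' = conj_set h O -> O = O'.
Proof.
move=> OO_O OO_O' Hh O'E; have [OOF /(_ O')[]] := OO_induced; first exact: OOF.
have [H1 _ _] := (subgroupE H).1 sH.
move=> P [_ uniqP]; rewrite -(uniqP O) ?(uniqP O') //; split=> //.
  by exists 1 => //; rewrite conj_set1.
by exists h.
Qed.

(** By [infinite_intersection_near] every member of [OO] is conjugate in [H] to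
    the intersection of [H] with one of finitely many stabilizers. *)
Lemma OO_finite : finite_set OO.
Proof.
pose R (bP : G * set G) := H `&` stab (act bP.1 (vp bP.2)).
apply: (@sub_finite_set _ _ (\bigcup_(bP in Bq `*` PP)
    [set O | OO O /\ exists2 h, H h & O = conj_set h (R bP)])).
  move=> O OO_O; have := OO_infinite OO_O.
  move: (OO_stab OO_O) => {1}-> /(infinite_intersection_near (cone_vO OO_O))[h [b [P [Hh Bb PP_P hv]]]].
  exists (b, P) => //; split=> //; exists h => //.
  by rewrite /R /= conj_setI conj_set_subgroup // -stab_act -actM hv; apply: OO_stab.
apply: bigcup_finite; first exact: finite_setX.
move=> bP _; set Z := [set O | _].
have [[O ZO]|none] := pselect (exists O, Z O); last first.
  by apply: (@sub_finite_set _ _ set0) => // O ZO; case: none; exists O.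
apply: (@sub_finite_set _ _ [set O]) (finite_set1 O) => O' [OO_O' [h' Hh' O'E]].
have [OO_O [h Hh OE]] := ZO; have [_ HV HM] := (subgroupE H).1 sH.
rewrite /=; apply/esym; apply: (@OO_conj_eq _ _ (h' * h^-1)) => //.
  by apply: HM => //; apply: HV.
by rewrite OE -conj_setM mulgVK.
Qed.

Lemma delta_le_max O n : OO O -> (distO O n <= f n)%N.
Proof.
move=> OO_O; apply: max_nat_ge; last by exists O.
by apply: finite_image; apply: OO_finite.
Qed.

Lemma delta_mono O m n : OO O -> (m <= n)%N -> (distO O m <= distO O n)%N.
Proof.
move=> OO_O; have [_ _ [finS genS] TOg] := OO_data OO_O.
by apply: distortion_mono => // o Oo; rewrite genS; apply: OO_sub.
Qed.

Lemma max_delta_le n m : (forall O, OO O -> (distO O n <= m)%N) -> (f n <= m)%N.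
Proof.
move=> dm; apply: max_nat_le; first by apply: finite_image; apply: OO_finite.
by move=> _ [O OO_O <-]; apply: dm.
Qed.

Lemma max_delta_mono m n : (m <= n)%N -> (f m <= f n)%N.
Proof.
move=> mn; apply: max_delta_le => O OO_O.
exact: leq_trans (delta_mono OO_O mn) (delta_le_max _ OO_O).
Qed.

Lemma max_delta0 : f 0%N = 0%N.
Proof.
apply/eqP; rewrite -leqn0; apply: max_delta_le => O OO_O.
have [_ _ [finS genS] TOg] := OO_data OO_O.
by rewrite distortion0 // => o Oo; rewrite genS; apply: OO_sub.
Qed.

(** An element of [O] of length [n] in the peripheral subgroup has length linear
    in [n] in [G]; its length in [H] bounds its length in [O]. *)
Lemma lower_bound (R : realType) : preceq R f (distortion S H T).
Proof.
have [||C1 C1P] := @finite_bound _ OO (fun C O => forall n o,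
    O o -> word T n o -> word (TO O) (C * n + C) o) OO_finite.
- by move=> m n O mn mP k o Oo /(mP k o Oo); apply: word_mono; rewrite leq_add ?leq_mul.
- move=> O OO_O; have [_ _ _ [_ TOO]] := OO_data OO_O.
  have YO : gen (TO O) = H `&` stab (vO O) by rewrite TOO; apply: OO_stab.
  have [C CP] := peripheral_undistorted (cone_vO OO_O) YO.
  by exists C => n o /(OO_in OO_O)[]; apply: CP.
have [||C2 C2P] := @finite_bound _ OO (fun C O => forall s, SO O s -> word S C s) OO_finite.
- by move=> m n O mn mP s /mP; apply: word_mono.
- move=> O OO_O; have [_ _ [finS _] _] := OO_data OO_O.
  by apply: word_bound finS _ => s _; rewrite SG.
apply: (@preceqI _ _ _ (C1 + C2)) => n N0 nN0; apply: max_delta_le => O OO_O.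
have [_ _ [finSO genSO] TOg] := OO_data OO_O.
apply: distortion_le => // [o Oo|o Oo on]; first by rewrite genSO; apply: OO_sub.
have [Ho _] := OO_in OO_O Oo.
have oS : word S N0 o.
  apply: word_mono (word_sub (C2P O OO_O) on).
  by apply: leq_trans nN0; rewrite mulnDl; lia.
have SH x : H x -> gen S x by rewrite SG.
have := distortion_word S_finite SH (conj T_finite TH) Ho oS.
move=> /(C1P O OO_O _ _ Oo); apply: word_mono.
by rewrite mulnDl; lia.
Qed.

(** Finitely many orbits of edges leave finitely many orbits of the stabilizer of
    [v] on the edges at [v]. *)
Lemma cofinite_link v : exists D, [/\ finite_set D, D `<=` link v &
  link v `<=` [set act q x | q in stab v & x in D]].
Proof.
have [E EP] := edge_orbits.
have [g gP] : {g : V * V -> G & forall ab,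
    (exists h, act h ab.2 = v) -> act (g ab) ab.2 = v}.
  apply: (@choice _ _ (fun ab g => _ -> act g ab.2 = v)) => ab.
  have [[h hv]|none] := pselect (exists h, act h ab.2 = v); first by exists h.
  by exists 1.
exists [set x | e x v /\ exists2 ab, ab \in E & x = act (g ab) ab.1]; split.
- apply: (@sub_finite_set _ _ [set act (g ab) ab.1 | ab in [set` E]]).
    by move=> x [_ [ab abE ->]]; exists ab.
  by apply: finite_image; apply: finite_seq.
- by move=> x [].
- move=> u uv; have [h [a [b [abE [hu hv]]]]] := EP u v uv.
  have gv : act (g (a, b)) b = v by apply: (gP (a, b)); exists h.
  exists (h * (g (a, b))^-1).
    by rewrite /vertex_stabilizer /= actM -{1}gv actK.
  exists (act (g (a, b)) a); last by rewrite actM actK.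
  split; last by exists (a, b).
  by rewrite -gv act_edge -(act_edge h) hu hv.
Qed.

(** The element [h^-1 * h'] of [H] lies in [b * P * b'^-1], so it differs by a
    fixed factor [r] from an element of the intersection of [H] with a conjugate
    of [P].  If this intersection is infinite, a fixed [k] in [H] conjugates some
    [O] in [OO] to it, and [k^-1 * h^-1] carries [v] to the vertex of [O]; the chain
    then bounds the length of the resulting element of [O] in the peripheral subgroup,
    and the distortion of [O] bounds its length in [H]. *)
Lemma peripheral_step n b P b' : Bq b -> PP P -> Bq b' -> exists C,
  forall g s h h' m u u', H h -> H h' -> g = h * b -> g * s = h' * b' -> P s ->
  let v := act g (vp P) in
  ent v (act g w) u -> ent v (act (g * s) w) u' -> chain (link v) v n m u u' ->
  word T (C * f (C * m + C) + C) (h^-1 * h').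
Proof.
move=> Bb PP_P Bb'; have [H1 HV HM] := (subgroupE H).1 sH.
have [P1 PV PM] : [/\ P 1, forall x, P x -> P x^-1 & forall x y, P x -> P y -> P (x * y)].
  by apply/subgroupE; rewrite -(stab_vp PP_P); apply: stab_subgroup.
pose y := act b (vp P); pose Q := H `&` stab y.
have tE g s h h' : g = h * b -> g * s = h' * b' -> h^-1 * h' = b * s * b'^-1.
  by move=> -> gs; rewrite -(mulgK b' h') -gs -!mulgA mulKg.
have [[s0 [Ps0 Hr]]|none] := pselect (exists s0, P s0 /\ H (b * s0 * b'^-1)); last first.
  exists 0%N => g s h h' m u u' Hh Hh' gE gs Ps; case: none; exists s.
  by split=> //; rewrite -(tE _ _ _ _ gE gs); apply: HM => //; apply: HV.
set r := b * s0 * b'^-1 in Hr.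
have Qt g s h h' : H h -> H h' -> g = h * b -> g * s = h' * b' -> P s ->
    Q (h^-1 * h' * r^-1).
  move=> Hh Hh' gE gs Ps; split.
    by apply: (HM); [apply: HM => //|]; apply: HV.
  rewrite (tE _ _ _ _ gE gs) /r !invgM invgK /vertex_stabilizer /= /y -actM.
  have -> : b * s * b'^-1 * (b' * (s0^-1 * b^-1)) * b = b * (s * s0^-1).
    by rewrite -!mulgA mulKg mulVg mulg1.
  by apply: act_stab => //; apply: PM => //; apply: PV.
have [finQ|infQ] := pselect (finite_set Q).
  have [||C CP] := @word_bound _ T [set q * r | q in Q].
  - exact: finite_image.
  - by move=> _ [q [Hq _] <-]; rewrite TH; apply: HM.
  exists C => g s h h' m u u' Hh Hh' gE gs Ps v gu gu' uu'.
  apply: (@word_mono _ _ C); first exact: leq_addl.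
  by apply: CP; exists (h^-1 * h' * r^-1); [apply: Qt gs Ps|rewrite mulgVK].
have [_ /(_ Q)[]] := OO_induced.
  by split=> //; exists b, P; rewrite /Q stab_act stab_vp.
move=> O [[OO_O [k Hk QE]] _]; have [PP_PO _ [finSO genSO] [finTO genTO]] := OO_data OO_O.
have kv : act k (vO O) = y.
  apply: contrapT => kv; apply: infQ; apply: sub_finite_set (stab_inter_finite kv).
  move=> q Qq; split; last by case: Qq.
  move: Qq; rewrite QE stab_act => -[o Oo <-]; exists o => //.
  by case: (OO_in OO_O Oo).
have kVy : act k^-1 y = vO O by rewrite -kv actK.
have cvO := cone_vO OO_O.
have [u1 ku1] := entrance_ex e_conn (@cone_neq _ (k^-1 * b) cvO).
have [u2 ku2] := entrance_ex e_conn (@cone_neq _ (k^-1 * r * b') cvO).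
have [D0 [finD0 D0v vD0]] := cofinite_link (vO O).
pose ball u : set V := [set u' | e u' (vO O) /\ det (vO O) N u u'].
have finball u : e u (vO O) -> finite_set (ball u).
  by move=> uv; apply: (link_finite e_sym e_fine turn_finite).
pose D := D0 `|` (ball u1 `|` ball u2).
have finD : finite_set D.
  by rewrite !finite_setU; split=> //; split; apply: finball; [case: ku1|case: ku2].
have Dv x : D x -> e x (vO O) by case=> [/D0v//|[[]|[]]].
have [C1 C1P] := chain_word n (stab_subgroup (vO O))
  (etrans genSO (esym (stab_vO OO_O))) (fun x => id) finD Dv.
have [C2 C2P] : exists C, forall o, TO O o -> word T C o.
  apply: word_bound finTO _ => o TOo; rewrite TH.
  by have /(OO_in OO_O)[] : O o by rewrite -genTO => L [_]; apply.
have [C3 C3P] : exists C, word T C k by apply/gen_word; rewrite TH.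
have [C4 C4P] : exists C, word T C r by apply/gen_word; rewrite TH.
exists (C1 + C2 + (C3 + C3 + C4))%N => g s h h' m u u' Hh Hh' gE gs Ps v gu gu' uu'.
have := Qt _ _ _ _ Hh Hh' gE gs Ps; rewrite QE => -[o Oo oE].
have [Ho ov] := OO_in OO_O Oo; have oVv : act o^-1 (vO O) = vO O by rewrite -{1}ov actK.
have hE : h^-1 * h' = k * o * k^-1 * r by rewrite oE mulgVK.
pose phi := k^-1 * h^-1.
have phiv : act phi v = vO O.
  by rewrite /v gE -actM /phi -mulgA mulKg actM kVy.
have phig : phi * g = k^-1 * b by rewrite gE /phi -mulgA mulKg.
have phigs : o^-1 * phi * (g * s) = k^-1 * r * b'.
  rewrite gs /phi -!mulgA (mulgA h^-1) hE -!mulgA.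
  by rewrite !mulKg.
have phic : chain [set act q x | q in stab (vO O) & x in D] (vO O) n m (act phi u) (act phi u').
  rewrite -{2}phiv; apply: chain_act uu' => x vx.
  have /vD0[q Oq [z Dz <-]] : link (vO O) (act phi x) by rewrite /link /= -phiv act_edge.
  by exists q => //; exists z => //; left.
have phiu : D (act phi u).
  have := entrance_act phi gu; rewrite -actM phig phiv => phiu.
  by right; left; split; [case: phiu|apply: entrance_close phiu].
have phiu' : D (act (o^-1 * phi) u').
  have := entrance_act (o^-1 * phi) gu'; rewrite -actM phigs actM phiv oVv => phiu'.
  by right; right; split; [case: phiu'|apply: entrance_close phiu'].
have [S1 _ _] := (subgroupE _).1 (stab_subgroup (vO O)).
have := C1P m _ _ 1 o _ _ phic S1 phiu (esym (act1 _)) ov phiu'.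
rewrite invg1 mul1g -actM mulVKg => /(_ erefl) oS.
have OSO x : O x -> gen (SO O) x by rewrite genSO; apply: OO_sub.
have := distortion_word finSO OSO (conj finTO genTO) Oo oS.
move=> /(word_sub C2P) oT; rewrite hE.
have := wordM (wordM (wordM C3P oT) (wordV C3P)) C4P; apply: word_mono.
set C := (C1 + C2 + _)%N.
have le1 : (distO O (C1 * m.+1) <= f (C * m + C))%N.
  apply: leq_trans (delta_le_max _ OO_O) _; apply: max_delta_mono.
  by rewrite -mulnSr leq_mul2r /C; lia.
have : (C2 * distO O (C1 * m.+1) <= C * f (C * m + C))%N.
  by apply: leq_mul le1; rewrite /C; lia.
have : (C3 + C3 + C4 <= C)%N by rewrite /C; lia.
by move: (C * _)%N; lia.
Qed.

Lemma growth_mono C C' m : (C <= C')%N ->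
  (C * f (C * m + C) + C <= C' * f (C' * m + C') + C')%N.
Proof.
move=> CC'; rewrite leq_add // leq_mul //; apply: max_delta_mono.
by rewrite leq_add ?leq_mul.
Qed.

(** There are finitely many choices of [b], [P] and [b'] in [peripheral_step], and
    the edges labelled by [A] contribute finitely many elements of [H]. *)
Lemma step_bound n : exists C, forall c k i m h h' b b',
  geodesicX c k -> (i < k)%N -> H h -> Bq b -> H h' -> Bq b' ->
  c i = h * b -> c i.+1 = h' * b' ->
  ((exists2 P, PP P & P ((c i)^-1 * c i.+1)) ->
    exists P u u', let v := act (c i) (vp P) in
    [/\ PP P, P ((c i)^-1 * c i.+1), ent v (act (c i) w) u,
        ent v (act (c i.+1) w) u' & chain (link v) v n m u u']) ->
  word T (C * f (C * m + C) + C) (h^-1 * h').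
Proof.
have [_ HV HM] := (subgroupE H).1 sH.
have [|||C1 C1P] := @finite_bound _ (Bq `*` (PP `*` Bq)) (fun C bPb =>
  forall g s h h' m u u', H h -> H h' -> g = h * bPb.1 -> g * s = h' * bPb.2.2 ->
  bPb.2.1 s -> let v := act g (vp bPb.2.1) in
  ent v (act g w) u -> ent v (act (g * s) w) u' -> chain (link v) v n m u u' ->
  word T (C * f (C * m + C) + C) (h^-1 * h')).
- by apply: finite_setX => //; apply: finite_setX.
- move=> m m' bPb mm' mP g s h h' l u u' Hh Hh' gE gs Ps v gu gu' uu'.
  by apply: word_mono (growth_mono _ mm') _; apply: mP gE gs Ps gu gu' uu'.
- by move=> [b [P b']] [/= Bb [PP_P Bb']]; apply: peripheral_step.
pose F := [set g | H g /\ exists b s b', [/\ Bq b, A s, Bq b' & g = b * s * b'^-1]].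
have [||C2 C2P] := @word_bound _ T F.
- apply: (@sub_finite_set _ _ [set q.1.1 * q.1.2 * (q.2)^-1 | q in Bq `*` A `*` Bq]).
    by move=> g [_ [b [s [b' [Bb As Bb' ->]]]]]; exists (b, s, b').
  by apply: finite_image; apply: finite_setX => //; apply: finite_setX.
- by move=> g [Hg _]; rewrite TH.
exists (C1 + C2)%N => c k i m h h' b b' gc ik Hh Bb Hh' Bb' cE cE' per.
have cs : c i.+1 = c i * ((c i)^-1 * c i.+1) by rewrite mulVKg.
have [/per[P [u [u' [PP_P Ps cu cu' uu']]]]|none] :=
    pselect (exists2 P, PP P & P ((c i)^-1 * c i.+1)).
  apply: (@word_mono _ _ (C1 * f (C1 * m + C1) + C1)).
    by apply: growth_mono; apply: leq_addr.
  apply: (C1P (b, (P, b')) _ (c i) ((c i)^-1 * c i.+1)) uu' => //=.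
  - by rewrite -cs.
  - by rewrite -cs.
apply: (@word_mono _ _ C2); first by lia.
apply: C2P; split; first by apply: HM => //; apply: HV.
exists b, ((c i)^-1 * c i.+1), b'; split=> //.
  by have [//|] := X_sub (geodesicX_step gc ik).
by rewrite cE' {1}cE invgM !mulgA mulgV mul1g mulgK.
Qed.

Lemma dist_word n g : word S n g -> (d w (act g w) <= M * n)%N.
Proof.
move=> /word_path[m [a [mn a0 am _ aS]]].
rewrite -am -{1}(act1 w) -a0; apply: leq_trans (_ : M * (m - 0) <= _)%N; last first.
  by rewrite subn0 leq_mul2l mn orbT.
apply: (@dist_chain _ _ _ M (fun t => act (a t) w)) => // t /= tm.
have /aS[/SA As|/SA As] : (t < m)%N by lia.
  by have := dist_orbit_A (a t) As; rewrite mulVKg.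
by rewrite (dist_sym e_sym); have := dist_orbit_A (a t.+1) As; rewrite mulVKg.
Qed.

(** Moving each vertex of a relative geodesic from [1] to [h] to a nearby element
    of [H] writes [h] as a product of elements to which [step_bound] applies; both
    their number and the sum of the lengths of their chains are linear in [n]. *)
Lemma upper_bound (R : realType) :
  preceq R (distortion S H T) (superadditive_closure f).
Proof.
have [H1 HV HM] := (subgroupE H).1 sH.
have [C1 C1P] := distX_le_orbit.
have [C2 C2P] := step_bound (4 * N).
have [||C3 C3P] := @word_bound _ T (Bq `&` H).
- exact: sub_finite_set (@subIsetl _ _ _) Bq_finite.
- by move=> g [_ Hg]; rewrite TH.
pose K := (C1 * M + C1)%N.
pose L := (2 * C3 + C2 * K + C2 * (4 * K + 2))%N.
apply: (@preceqI _ _ _ (L + C2)) => n N0 nN0.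
have SH x : H x -> gen S x by rewrite SG.
apply: distortion_le => // h Hh hn.
have [c [c0 ck gc cb]] := geodesicX_ex 1 h; set k := dX 1 h in ck gc cb.
have kn : (k <= K * n + K)%N.
  apply: leq_trans (C1P 1 h) _; rewrite act1.
  have : (C1 * d w (act h w) <= C1 * (M * n))%N by rewrite leq_mul2l dist_word ?orbT.
  by rewrite /K mulnDl mulnA; lia.
have [m [summ mP]] := total_chain_length gc c0 ck hn.
have [hb hbP] : {hb : nat -> G * G & forall i, (i <= k)%N ->
    [/\ H (hb i).1, Bq (hb i).2 & c i = (hb i).1 * (hb i).2]}.
  apply: (@choice _ _ (fun i hb => (i <= k)%N -> [/\ H hb.1, Bq hb.2 & c i = hb.1 * hb.2])) => i.
  have [ik|] := leqP i k; last by exists (1, 1).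
  by have [a [b [Ha Bb cE]]] := H_quasiconvex H1 Hh (cb i ik); exists (a, b).
pose s i := (C2 * m i + C2)%N.
have along i : (i <= k)%N ->
    word T (C3 + \sum_(0 <= j < i) (C2 * f (s j) + C2)) (hb i).1.
  elim: i => [|i IHi] ik.
    rewrite big_geq // addn0; have [H0 B0 cE] := hbP 0%N ik.
    rewrite -[(hb 0%N).1]invgK; apply: wordV; apply: C3P.
    have hE : (hb 0%N).1^-1 = (hb 0%N).2 by apply: mulg1_eq; rewrite -cE.
    by split; [rewrite hE|apply: HV].
  have [Hi Bi ciE] := hbP i (ltnW ik); have [Hi' Bi' ciE'] := hbP i.+1 ik.
  rewrite big_nat_recr //= addnA -(mulVKg (hb i).1 (hb i.+1).1).
  apply: wordM; first by apply: IHi; apply: ltnW.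
  exact: C2P gc ik Hi Bi Hi' Bi' ciE ciE' (mP i ik).
have [Hk Bk ckE] := hbP k (leqnn k).
have hkE : h = (hb k).1 * (hb k).2 by rewrite -ckE ck.
have last_k : word T C3 (hb k).2.
  apply: C3P; split=> //; rewrite -(mulKg (hb k).1 (hb k).2) -hkE.
  by apply: HM => //; apply: HV.
rewrite hkE; have := wordM (along k (leqnn k)) last_k; apply: word_mono.
have sum_f : (\sum_(0 <= j < k) f (s j) <= superadditive_closure f N0)%N.
  have := @superadditive_closure_ge f (map s (index_iota 0 k)) N0 max_delta0.
  rewrite -map_comp !sumnE !big_map; apply.
  rewrite /s big_split /= sum_nat_const_nat subn0 -big_distrr /=.
  apply: leq_trans nN0.
  have : (C2 * \sum_(0 <= i < k) m i <= C2 * (3 * (K * n + K) + n + 1))%N.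
    by rewrite leq_mul2l; apply/orP; right; lia.
  have : (k * C2 <= C2 * (K * n + K))%N by rewrite mulnC leq_mul2l kn orbT.
  by rewrite /L; move: (C2 * \sum_(_ <= _ < _) _)%N (k * C2)%N; nia.
rewrite big_split /= -big_distrr /= sum_nat_const_nat subn0.
have : (C2 * \sum_(0 <= j < k) f (s j) <= C2 * superadditive_closure f N0)%N.
  by rewrite leq_mul2l sum_f orbT.
have : (k * C2 <= C2 * (K * n + K))%N by rewrite mulnC leq_mul2l kn orbT.
move: (C2 * \sum_(_ <= _ < _) _)%N (k * C2)%N (superadditive_closure _ _).
by rewrite /L; nia.
Qed.

End Penetration.

Lemma distortion_bounds (R : realType) :
  preceq R f (distortion S H T) /\
  preceq R (distortion S H T) (superadditive_closure f).
Proof.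
have [N [k1 k2 k3 k4 k5]] := bounded_penetration.
by split; [apply: (@lower_bound N)|apply: (@upper_bound N)].
Qed.

End Action.

(** * A free orbit of leaves *)

Section Leaves.
Variables (G : groupType) (V : eqType) (e : rel V) (act : G -> V -> V) (w0 : V).
Hypotheses (e_sym : symmetric e) (e_irr : irreflexive e).
Hypothesis actP : graph_action e act.
Hypothesis e_conn : connected_graph e.

Local Open Scope group_scope.
Local Notation leafy := (V + G)%type.

(** Attaching to each [act g w0] a leaf labelled by [g] creates vertices with
    trivial stabilizer and changes neither the infinite stabilizers nor the
    coarse geometry. *)
Definition base (z : leafy) : V := match z with inl x => x | inr g => act g w0 end.

Definition is_leaf (z : leafy) : bool := if z is inr _ then true else false.

Definition leafy_edge : rel leafy := fun a b =>
  match a, b with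
  | inl x, inl y => e x y
  | inl x, inr g | inr g, inl x => x == act g w0
  | inr _, inr _ => false
  end.

Definition leafy_act (g : G) (z : leafy) : leafy :=
  match z with inl x => inl (act g x) | inr h => inr (g * h) end.

Lemma leafy_sym : symmetric leafy_edge.
Proof. by move=> [x|g] [y|h] //=. Qed.

Lemma leafy_irr : irreflexive leafy_edge.
Proof. by move=> [x|g] /=. Qed.

Lemma leafy_action : graph_action leafy_edge leafy_act.
Proof.
split=> [[x|g]|g h [x|k]|g [x|h] [y|k]] //=.
- by rewrite (act1 actP).
- by rewrite mul1g.
- by rewrite (actM actP).
- by rewrite mulgA.
- exact: (act_edge actP).
- by rewrite (actM actP); apply/eqP/eqP => [/(act_inj actP)|->].
- by rewrite (actM actP); apply/eqP/eqP => [/(act_inj actP)|->].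
Qed.

Lemma leafy_path x y p : edge_path e x y p ->
  edge_path leafy_edge (inl x) (inl y) (map inl p).
Proof.
case=> xp <-; split; last by rewrite last_map.
by elim: p x xp => //= z p IHp x /andP[-> /IHp].
Qed.

Lemma to_leaf z : exists2 p, edge_path leafy_edge (inl (base z)) z p & size p = is_leaf z.
Proof.
by case: z => [x|g]; [exists [::]|exists [:: inr g]; rewrite // /edge_path /= eqxx].
Qed.

Lemma from_leaf z : exists2 p, edge_path leafy_edge z (inl (base z)) p & size p = is_leaf z.
Proof.
by case: z => [x|g]; [exists [::]|exists [:: inl (act g w0)]; rewrite // /edge_path /= eqxx].
Qed.

Lemma leafy_conn : connected_graph leafy_edge.
Proof.
split=> [|a b]; first by have [[x] _] := e_conn; split; left.
have [p ap _] := from_leaf a; have [q bq _] := to_leaf b.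
have [_ /(_ (base a) (base b))[r /leafy_path ar]] := e_conn.
by exists ((p ++ map inl r) ++ q); apply: edge_path_cat bq; apply: edge_path_cat ar.
Qed.

Local Notation d := (dist e_conn).
Local Notation d' := (dist leafy_conn).

(** The right-hand side changes by at most one along an edge, so it bounds the
    length of any path from below. *)
Lemma leafy_dist a b : a <> b -> d' a b = (d (base a) (base b) + is_leaf a + is_leaf b)%N.
Proof.
move=> ab; apply/eqP; rewrite eqn_leq; apply/andP; split.
  have [p ap sp] := from_leaf a; have [q bq sq] := to_leaf b.
  have [r /leafy_path ar sr] := geodesic_path e_conn (base a) (base b).
  have := dist_le_size leafy_conn (edge_path_cat (edge_path_cat ap ar) bq).
  by rewrite !size_cat size_map sp sq sr; lia.
have [p [ap pb] <-] := geodesic_path leafy_conn a b.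
pose D x y := if x == y then 0%N else (d (base x) (base y) + is_leaf x + is_leaf y)%N.
have Dstep x y z : leafy_edge x y -> (D x z <= (D y z).+1)%N.
  rewrite /D; have [//|xz] := eqVneq x z; have [<-|yz] := eqVneq y z.
    case: x y xz => [x|g] [y|h] //= _.
    - by move=> /(dist_edge e_conn); lia.
    - by move=> /eqP ->; rewrite distxx.
    - by move=> /eqP ->; rewrite distxx.
  move=> xy; have := dist_triangle e_conn (base y) (base x) (base z).
  suff : (d (base x) (base y) + is_leaf x <= is_leaf y + 1)%N by lia.
  case: x y xy {xz yz} => [x|g] [y|h] //= => [/(dist_edge e_conn)|/eqP ->|/eqP ->].
  - by rewrite addn0.
  - by rewrite distxx.
  - by rewrite distxx.
suff : (D a b <= size p)%N by rewrite /D; case: eqVneq => // /ab.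
elim: p a ap pb {ab} => [|c p IHp] a /= => [_ ->|/andP[ac cp] pb].
  by rewrite /D eqxx.
by apply: leq_trans (Dstep _ _ b ac) _; rewrite ltnS; apply: IHp.
Qed.

Lemma leafy_btw x v y : btw leafy_conn x v y -> btw e_conn (base x) (base v) (base y).
Proof.
have [->|vx] := pselect (v = x); first by move=> _; apply: btw_l.
have [->|vy] := pselect (v = y); first by move=> _; apply: btw_r.
have [<-|xy] := pselect (x = y); first by move=> /btw_refl.
rewrite /btw !leafy_dist //; last exact: nesym.
by have := dist_triangle e_conn (base v) (base x) (base y); lia.
Qed.

(** If [y] and [b] are the same leaf, its base is not between them; whence [t']. *)
Lemma btw_leafy y t b : btw e_conn (base y) t (base b) ->
  exists2 t', (d' (inl t) t' <= 1)%N & btw leafy_conn y t' b.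
Proof.
have [<-|yb] := pselect (y = b).
  move=> /btw_refl ->; exists y; last exact: btw_l.
  have [p yp sp] := to_leaf y; apply: leq_trans (dist_le_size _ yp) _.
  by rewrite sp leq_b1.
move=> ytb; exists (inl t); first by rewrite distxx.
have [<-|ty] := pselect (inl t = y); first exact: btw_l.
have [->|tb] := pselect (inl t = b); first exact: btw_r.
rewrite /btw !leafy_dist //=; last exact: nesym.
by move: ytb; rewrite /btw; lia.
Qed.

Lemma leafy_thin delta : thin e_conn delta -> thin leafy_conn (delta + 2).
Proof.
move=> e_thin x y z v b /leafy_btw xvy /leafy_btw ybz.
have [t vt tE] := e_thin _ _ _ _ _ xvy ybz.
have vt' : (d' v (inl t) <= delta + 1)%N.
  have [->|vt'] := pselect (v = inl t); first by rewrite distxx.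
  by rewrite leafy_dist //=; case: (is_leaf v); lia.
have near t' : (d' (inl t) t' <= 1)%N -> (d' v t' <= delta + 2)%N.
  by have := dist_triangle leafy_conn (inl t) v t'; lia.
by case: tE => /btw_leafy[t' /near vt'' bt']; exists t' => //; [apply: Or31|apply: Or32|apply: Or33].
Qed.

(** A path that avoids [inl x] can only enter leaves that do not hang from [x];
    such an excursion comes back to the base of the leaf. *)
Lemma leafy_fine : fine_links e -> fine_links leafy_edge.
Proof.
move=> e_fine [x|h] a n av; last first.
  apply: (@sub_finite_set _ _ [set inl (act h w0)]) (finite_set1 _) => -[y|k] [] //=.
  by move=> /eqP -> _.
have project p c : path leafy_edge c p -> inl x \notin p -> base c <> x ->
    exists q, [/\ path e (base c) q, last (base c) q = base (last c p),
                  x \notin base c :: q & (size q <= size p)%N].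
  elim: p c => [|c' p IHp] c /=.
    by move=> _ _ cx; exists [::]; split=> //; rewrite inE; apply/eqP => /esym.
  move=> /andP[cc' c'p]; rewrite in_cons negb_or => /andP[xc' xp] cx.
  have c'x : base c' <> x.
    case: c c' cc' xc' cx {c'p} => [y|g] [y'|g'] //=.
    - by move=> _ /eqP xy' _ y'x; apply: xy'; rewrite y'x.
    - by move=> /eqP <-.
    - by move=> /eqP <-.
  have [q [c'q qp xq sq]] := IHp c' c'p xp c'x.
  have [E|cc'e] : base c = base c' \/ e (base c) (base c').
    by case: c c' cc' {c'p cx xc' c'x q c'q qp xq sq} => [y|g] [y'|g'] //= => [|/eqP|/eqP]; [right|left|left].
  by exists q; rewrite E; split=> //; apply: leqW.
  exists (base c' :: q); split=> //=; first by rewrite cc'e.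
  by rewrite in_cons negb_or xq andbT; apply/eqP => /esym.
case: a av => [u|g] /= au.
  apply: (@sub_finite_set _ _ [set inl y | y in link_sphere e x u n]); last first.
    by apply: finite_image; apply: e_fine.
  move=> z [xz [p [up pz xp sp]]].
  have ux : base (inl u) <> x by move=> /= ux; move: au; rewrite ux e_irr.
  have [|q [uq qz xq sq]] := project p (inl u) up _ ux.
    by apply: contra xp; rewrite in_cons orbC => ->.
  rewrite pz in qz; case: z xz pz qz => [y|g] /= xz pz qz.
    by exists y => //; split=> //; exists q; split=> //; apply: leq_trans sp.
  by case/negP: xq; rewrite (eqP xz) -qz mem_last.
apply: (@sub_finite_set _ _ [set inr g]) (finite_set1 _) => z [_ [[|c p]]] /=.
  by case=> _ <-.
case=> /andP[gc _] _ xp _; move: xp; case: c gc => [y|//] /eqP yg.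
by rewrite !in_cons (eqP au) yg eqxx orbT.
Qed.

Lemma leafy_stab_inl v : vertex_stabilizer leafy_act (inl v) = vertex_stabilizer act v.
Proof. by apply/seteqP; split=> g; [case|move=> gv; congr inl]. Qed.

Lemma leafy_stab_inr h : vertex_stabilizer leafy_act (inr h) = [set 1].
Proof.
apply/seteqP; split=> [g [gh]|_ ->]; last by congr inr; rewrite mul1g.
by rewrite /= -(mulgK h g) gh mulgV.
Qed.

Lemma leafy_edge_stab_finite :
  (forall x y, e x y -> finite_set (edge_stabilizer act x y)) ->
  forall a b, leafy_edge a b -> finite_set (edge_stabilizer leafy_act a b).
Proof.
move=> stab_finite [x|g] [y|h] //= ab.
- apply: sub_finite_set (stab_finite x y ab) => k.
  by move=> [[[kx] [ky]]|[[kx] [ky]]]; [left|right].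
- apply: (@sub_finite_set _ _ [set 1]) (finite_set1 _) => k.
  by move=> [[_ kh]|[//]]; rewrite -(leafy_stab_inr h).
- apply: (@sub_finite_set _ _ [set 1]) (finite_set1 _) => k.
  by move=> [[kh _]|[//]]; rewrite -(leafy_stab_inr g).
Qed.

Lemma leafy_edge_orbits : finitely_many_edge_orbits e act ->
  finitely_many_edge_orbits leafy_edge leafy_act.
Proof.
move=> [E EP]; exists [:: (inl w0, inr 1), (inr 1, inl w0) & [seq (inl ab.1, inl ab.2) | ab <- E]].
move=> [x|g] [y|h] //= xy.
- have [k [a [b [abE [ka kb]]]]] := EP x y xy.
  exists k, (inl a), (inl b); rewrite /= ka kb; split=> //.
  by rewrite !in_cons (map_f (fun ab => (inl ab.1, inl ab.2)) abE : (inl a, inl b) \in _) !orbT.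
- exists h, (inl w0), (inr 1); rewrite in_cons eqxx; split=> //=.
  by rewrite (eqP xy) mulg1.
- exists g, (inr 1), (inl w0); rewrite !in_cons eqxx orbT; split=> //=.
  by rewrite (eqP xy) mulg1.
Qed.

End Leaves.

(** * The theorem *)

(** The allowed turns are those of finitely many fixed geodesics. *)
Lemma finite_geodesics (V : eqType) (e : rel V) (e_conn : connected_graph e)
    (w : V) (Z : set V) : finite_set Z ->
  exists (turns : set (V * V * V)) M, finite_set turns /\ forall z, Z z -> exists p,
    [/\ edge_path e w z p, {subset triples w p <= turns} & size p <= M].
Proof.
move=> finZ.
have [p pP] : {p : V -> seq V & forall z, edge_path e w z (p z) /\ size (p z) = dist e_conn w z}.
  apply: (@choice _ _ (fun z p => edge_path e w z p /\ size p = dist e_conn w z)) => z.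
  by have [p wp sp] := geodesic_path e_conn w z; exists p.
have [||M MP] := finite_bound (P := fun M z => size (p z) <= M) finZ.
- by move=> m n z mn zm; apply: leq_trans mn.
- by move=> z _; exists (size (p z)).
exists (\bigcup_(z in Z) [set` triples w (p z)]), M; split.
  by apply: bigcup_finite => // z _; apply: finite_seq.
move=> z Zz; exists (p z); split=> //; [by case: (pP z)| |exact: MP].
by move=> t tz; rewrite inE; exists z.
Qed.

Section RelativeCayley.
Variables (G : groupType) (PP : set (set G)) (S : set G).
Local Open Scope group_scope.
Hypothesis PP_sub : forall P, PP P -> is_subgroup P.
Hypothesis S_gen : relative_generating_set PP S.

Lemma relative_cayley_conn : connected_graph (cayley (S `|` peripheral_elements PP)).
Proof.
set X := _ `|` _; split=> [|x y]; first by split; exact: 1.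
have [S_sym genS] := S_gen.
have edge s z : (S `|` \bigcup_(P in PP) P) s \/ (S `|` \bigcup_(P in PP) P) s^-1 ->
    exists p, edge_path (cayley X) z (z * s) p.
  move=> Ys; have [->|s1] := eqVneq s 1; first by exists [::]; split; rewrite ?mulg1.
  exists [:: z * s]; split=> //=; rewrite andbT /cayley mulKg inE.
  have Ps P : PP P -> P s -> X s.
    by move=> PP_P Ps; right; split; [exists P|apply/eqP].
  case: Ys => [[Ss|[P PP_P Ps']]|[/S_sym|[P PP_P Ps']]].
  - by left.
  - exact: Ps Ps'.
  - by rewrite invgK; left.
  - apply: (Ps P PP_P); have [_ PV _] := (subgroupE P).1 (PP_sub PP_P).
    by rewrite -(invgK s); apply: PV.
have : gen (S `|` \bigcup_(P in PP) P) (x^-1 * y) by rewrite genS.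
move=> /gen_word[n [l [_ lE lS]]]; rewrite -(mulVKg x y) -lE {lE n}.
elim: l x lS => [|s l IHl] x lS; first by exists [::]; split; rewrite // big_nil mulg1.
have [p xp] := edge s x (lS s (mem_head _ _)).
have [t tl|q sq] := IHl (x * s); first by apply: lS; rewrite in_cons tl orbT.
by exists (p ++ q); rewrite big_cons mulgA; apply: edge_path_cat sq.
Qed.

End RelativeCayley.

(* For O in OO, the group O is H `&` gO O . PO O . (gO O)^-1, where gO O and
   PO O are any such choice, and SO O and TO O are finite generating sets of
   that conjugate and of O. *)
Theorem theorem1p4 (R : realType) (G : groupType) (PP : set (set G))
    (S H T : set G) (OO : set (set G))
    (gO : set G -> G) (PO SO TO : set G -> set G) :
  relatively_hyperbolic PP ->
  finite_generating_set S [set: G] ->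
  relatively_quasiconvex R PP H ->
  finite_generating_set T H ->
  induced_peripheral_structure PP H OO ->
  (forall O, OO O ->
     [/\ PP (PO O), O = H `&` conj_set (gO O) (PO O),
         finite_generating_set (SO O) (conj_set (gO O) (PO O))
       & finite_generating_set (TO O) O]) ->
  let delta (O : set G) := distortion (SO O) O (TO O) in
  let f (n : nat) := max_nat [set delta O n | O in OO] in
  preceq R f (distortion S H T) /\
  preceq R (distortion S H T) (superadditive_closure f).
Proof.
move=> [_ PP_finite [V [e [act [[e_sym e_irr actP] [geom [stab_fin orbits PP_repr]]]]]]].
move=> [S_finite SG] [sH [S' [dG [kappa [S'_finite S'_gen [d_metric d_proper d_inv] qc]]]]].
move=> [T_finite TH] OO_induced OO_data.
case: geom => e_conn e_hyp e_fine; case: e_hyp => delta slim.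
have [[w0] _] := e_conn.
have [PP_sub PP_uniq] : _ /\ _ := PP_repr.
have PP_infinite P : PP P -> infinite_set P by move=> /PP_sub[].
have [vp vpP] : {vp : set G -> V & forall P, PP P -> vertex_stabilizer act (vp P) = P}.
  apply: (@choice _ _ (fun P v => PP P -> vertex_stabilizer act v = P)) => P.
  by have [/PP_sub[_ [v ->]]|] := pselect (PP P); [exists v|exists w0].
have PP_conj P Q (g : G) : PP P -> PP Q -> P = conj_set g Q -> P = Q.
  move=> PP_P PP_Q PQ; have [|P' [_ uniqP]] := PP_uniq P; first exact: PP_sub.
  rewrite -(uniqP P) ?(uniqP Q) //; split=> //; first by exists g.
  by exists 1%g; rewrite ?conj_set1.
have PP_subgroup P : PP P -> is_subgroup P.
  by move=> PP_P; rewrite -(vpP P PP_P); apply: (stab_subgroup actP).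
pose lact := leafy_act act; pose w : V + G := inr 1%g.
pose lconn := leafy_conn act w0 e_conn.
have l_stab_PP v : infinite_set (vertex_stabilizer lact v) ->
    exists P g, PP P /\ vertex_stabilizer lact v = conj_set g P.
  case: v => [v|h]; last by rewrite leafy_stab_inr => /(_ (finite_set1 _)).
  rewrite leafy_stab_inl => inf_v.
  have [|P [[PP_P [g _ vE]] _]] := PP_uniq (vertex_stabilizer act v).
    by split=> //; exists v.
  by exists P, g.
pose A := S `|` (S' `|` T); pose X := S' `|` peripheral_elements PP.
have A_finite : finite_set A by rewrite !finite_setU.
pose Z := [set lact s w | s in A] `|` [set inl (vp P) | P in PP].
have Z_finite : finite_set Z by rewrite finite_setU; split; apply: finite_image.
have [turns [M [turns_finite pathZ]]] := finite_geodesics lconn w Z_finite.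
have cconn : connected_graph (cayley X) := relative_cayley_conn PP_subgroup S'_gen.
have [d0 d_sym d_tri] : is_metric dG := d_metric.
pose Bq := [set b | (dG 1%g b <= kappa)%R].
have H_near x y v : H x -> H y -> btw cconn x v y ->
    exists h b, [/\ H h, Bq b & v = (h * b)%g].
  move=> Hx Hy xvy.
  have [p xp sp] := geodesic_path cconn x v; have [q vq sq] := geodesic_path cconn v y.
  have vpq : v \in x :: p ++ q by rewrite -cat_cons mem_cat; case: xp => _ <-; rewrite mem_last.
  have [h Hh vh] := qc x y _ Hx Hy (geodesic_cat xp vq sp sq xvy) v vpq.
  exists h, (h^-1 * v)%g; split=> //; last by rewrite mulVKg.
  by rewrite /Bq /= d_sym -(d_inv h) mulVKg mulg1.
move=> dlt f; rewrite /f /dlt.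
have l_thin := @leafy_thin G V e act w0 e_conn delta (slim_thin slim).
have l_fine := @leafy_fine G V e act w0 e_irr (fine_graph_links e_sym e_fine).
have l_stab := @leafy_edge_stab_finite G V e act w0 stab_fin.
have l_orbits := leafy_edge_orbits w0 orbits.
have SA : S `<=` A by move=> s; left.
have TA : T `<=` A by move=> s; do 2 right.
apply: (distortion_bounds (leafy_sym act w0 e_sym) (leafy_irr act w0 e_irr)
  (leafy_action w0 actP) l_thin l_fine l_stab l_orbits turns_finite (w := w)
  (vp := fun P => inl (vp P)) PP_finite _ PP_infinite PP_conj l_stab_PP _ (A := A) (M := M)
  _ _ (X := X) _ _ (cayley_conn := cconn) sH (Bq := Bq) _ H_near SA TA
  TH A_finite S_finite SG T_finite OO_induced OO_data R).
- by move=> P PP_P; rewrite leafy_stab_inl; apply: vpP.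
- by rewrite leafy_stab_inr; apply: finite_set1.
- by move=> s As; apply: pathZ; left; exists s.
- by move=> P PP_P; apply: pathZ; right; exists P.
- by move=> s [S's|[[P PP_P Ps] _]]; [left; right; left|right; exists P].
- by move=> P s PP_P Ps s1; right; split; [exists P|].
- exact: d_proper.
Qed.
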